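(* Let $m\ge1$ be an integer and let $f:[-1,1]\to\mathbb{R}$ be such that $f,f',\ldots,f^{(m-1)}$ are absolutely continuous on $\Omega=[-1,1]$ and $f^{(m)}$ is of bounded variation on $\Omega$, i.e. $V_m=\mathcal{V}(f^{(m)},\Omega)<\infty$. Let $f_n$ be the Legendre projection of $f$ of degree $n$. (i) For $n\ge m$, $$\max_{x\in\Omega}(1-x^2)^{1/4}|f(x)-f_n(x)|\le\frac{2V_m}{m\pi}\prod_{j=1}^m\frac{1}{n-j+1/2}.$$ (ii) Suppose that there are $\tau\in(-1,1)$ and $n_0$ such that for all $n\ge n_0$ the maximum error of $f_n$ is attained at $\tau$, i.e. $|f(\tau)-f_n(\tau)|=\|f-f_n\|_{L^\infty(\Omega)}$. Then, for $n\ge\max\{n_0,m\}$, $$\|f-f_n\|_{L^\infty(\Omega)}\le\frac{2V_m}{\pi m(1-\tau^2)^{1/4}}\prod_{j=1}^m\frac{1}{n-j+1/2}.$$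
   Context: $P_k(x)$ denotes the Legendre polynomial of degree $k$, normalized by $P_k(1)=1$. The Legendre projection of degree $n$ is $f_n(x)=\sum_{k=0}^na_kP_k(x)$ with $a_k=(k+\frac12)\int_{-1}^1f(x)P_k(x)\,\mathrm{d}x$. The total variation of a function $g$ on $[-1,1]$ is $\mathcal{V}(g,[-1,1])=\sup\sum_{j=1}^{N}|g(x_j)-g(x_{j-1})|$, the supremum being over all partitions $-1=x_0<x_1<\cdots<x_N=1$. The derivative $f^{(m)}$ of the absolutely continuous function $f^{(m-1)}$ exists almost everywhere; that $f^{(m)}$ is of bounded variation means that it coincides almost everywhere with a function on $[-1,1]$ of bounded variation (again denoted $f^{(m)}$), and $V_m$ is the total variation of that function. *)

(* Defs.v *)
From HB Require Import structures.
From mathcomp Require Import all_boot all_order all_algebra.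
From mathcomp Require Import all_classical all_reals all_analysis.

Set Implicit Arguments.
Unset Strict Implicit.
Unset Printing Implicit Defensive.

Import Order.TTheory GRing.Theory Num.Theory.
Import numFieldTopology.Exports numFieldNormedType.Exports.

Local Open Scope classical_set_scope.
Local Open Scope ring_scope.

(* A function on [-1, 1] is represented by a total function on R; nothing below
   depends on the values it takes outside [-1, 1]. *)
Definition Omega (R : realType) : set R := `[-1, 1]%classic.
Arguments Omega {R}.

(* Derivative relative to the set A. With A = [-1, 1] this is the usual
   derivative in the interior and the one-sided derivative at -1 and 1. *)
Definition diff_quotient (R : realType) (f : R -> R) (x y : R) : R :=
  (f y - f x) / (y - x).

Definition is_derive_on (R : realType) (A : set R) (f : R -> R) (x l : R) :=
  diff_quotient f x y @[y --> within A x^'] --> l.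

Definition derivable_on (R : realType) (A : set R) (f : R -> R) (x : R) :=
  cvg (diff_quotient f x y @[y --> within A x^']).

Definition derive_on (R : realType) (A : set R) (f : R -> R) (x : R) : R :=
  lim (diff_quotient f x y @[y --> within A x^']).

Definition derivn_on (R : realType) (A : set R) (k : nat) (f : R -> R) :
  R -> R := iter k (derive_on A) f.

Definition absolutely_continuous (R : realType) (a b : R) (f : R -> R) :=
  forall e : R, 0 < e -> exists2 d : R, 0 < d &
    forall (N : nat) (u v : 'I_N -> R),
      (forall i, a <= u i /\ u i <= v i /\ v i <= b) ->
      trivIset [set: 'I_N] (fun i => `]u i, v i[%classic) ->
      \sum_i (v i - u i) < d -> \sum_i `|f (v i) - f (u i)| < e.

(* Rodrigues' formula; this is the normalization with value 1 at 1. *)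
Definition legendre (R : realType) (k : nat) : {poly R} :=
  (2 ^+ k * k`!%:R)^-1 *: (('X ^+ 2 - 1) ^+ k)^`(k).

Definition legendre_coef (R : realType) (f : R -> R) (k : nat) : R :=
  (k%:R + 2^-1) *
  \int[@lebesgue_measure R]_(x in Omega) (f x * (legendre R k).[x]).

Definition legendre_proj (R : realType) (f : R -> R) (n : nat) (x : R) : R :=
  \sum_(0 <= k < n.+1) legendre_coef f k * (legendre R k).[x].

Definition Linfty_norm (R : realType) (f : R -> R) : \bar R :=
  Lnorm (@lebesgue_measure R) +oo%E (EFin \o (f \_ Omega)).

Definition is_maximum_on (R : realType) (A : set R) (h : R -> R) (M : R) :=
  (exists2 x, A x & h x = M) /\ (forall x, A x -> h x <= M).

(* Main.v *)
(* Integrating by parts m times and once more against dg, the coefficient a_k of f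
   is a combination of integrals of (P_(i+1) - P_(i-1)) / 2 against dg with
   i >= k - m; the factors 1 / (k - j + 1/2) come from the recurrence
   a_k(F) = a_(k-1)(F') / (2k - 1) - a_(k+1)(F') / (2k + 3).  Both
   |P_(k+1) - P_(k-1)| / 2 and (1 - x^2)^(1/4) |P_k| are at most
   sqrt ((2 / pi) / (k - 1/2)), for k >= 1 and k >= 2 respectively: by Sonin's
   method each is dominated by a function of x that is maximal at 0, and Wallis'
   product controls P_k(0).  Multiplying the two bounds makes the sum of the |a_k| (1 - x^2)^(1/4) |P_k(x)| over k > n
   telescope to the right-hand side.  That this series represents f - f_n follows
   from the Christoffel-Darboux formula and Bessel's inequality applied to the
   (bounded) difference quotient of f at x. *)
Require Import Defs.
From HB Require Import structures.
From mathcomp Require Import all_boot all_order all_algebra.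
From mathcomp Require Import all_classical all_reals all_analysis.
From mathcomp Require Import measurable_realfun.
From mathcomp Require Import ring lra zify.

Import Order.TTheory GRing.Theory Num.Theory.
Import numFieldTopology.Exports numFieldNormedType.Exports.

Local Open Scope classical_set_scope.
Local Open Scope ring_scope.

(** * Identities for Legendre polynomials *)

(** The last derivative is known only almost everywhere, so integration by parts rests on a
    fundamental theorem of calculus for absolutely continuous functions whose almost everywhere
    derivative is a bounded measurable function: the difference from the indefinite integral has
    derivative 0 almost everywhere and is shown to be constant. No Stieltjes integral is formed: for
    q vanishing at both ends, the integral of g q' is bounded by sup |q| times the variation of g
    through uniform partitions. The difference quotient of f is bounded because f is Lipschitz, its
    first derivative being bounded. Convergence of the whole series is never proved: for each e > 0,
    a single N >= n with weighted error at most e at x suffices. Bernstein's bound is needed only in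
    degrees k > n >= m >= 1, so its restriction to k >= 2 costs nothing. *)

Section legendre_algebra.
Variable R : realType.
Local Notation P := (legendre R).
Local Notation u := ('X ^+ 2 - 1 : {poly R}).

Let rod (k : nat) : {poly R} := (u ^+ k)^`(k).

Lemma deriv_sqrXB1 : u^`() = 'X *+ 2.
Proof. by rewrite derivB derivXn derivC subr0 expr1. Qed.

Lemma derivnMX (k : nat) (p : {poly R}) :
  ('X * p)^`(k.+1) = 'X * p^`(k.+1) + p^`(k) *+ k.+1.
Proof.
elim: k => [|k IH].
  rewrite !derivn1 derivM derivX mul1r derivn0; ring.
rewrite derivnS IH derivD derivM derivX mul1r derivMn -!derivnS; ring.
Qed.

Lemma deriv_sqrXB1_exp (k : nat) : (u ^+ k.+1)^`() = 'X * (u ^+ k *+ (k.+1).*2).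
Proof. rewrite deriv_exp deriv_sqrXB1 /=; rewrite -muln2; ring. Qed.

(** Since X^2 = u + 1, two derivatives lead back to powers of u alone; differentiating k + 1 more
    times gives the recurrence [rod_rec2], free of the factor X. *)
Lemma deriv2_sqrXB1_exp (k : nat) : (u ^+ k.+2)^`()^`() =
  u ^+ k.+1 *+ (2 * k.+2 * (2 * k.+1 + 1)) + u ^+ k *+ (4 * k.+1 * k.+2).
Proof.
rewrite deriv_sqrXB1_exp derivM derivX mul1r derivMn deriv_sqrXB1_exp -!muln2.
rewrite (_ : 'X * ('X * (u ^+ k *+ (k.+1 * 2)) *+ (k.+2 * 2)) =
  ((u + 1) * u ^+ k) *+ (4 * k.+1 * k.+2)).
  rewrite mulrDl mul1r -exprS mulrnDl addrA -mulrnDr; congr (_ *+ _ + _); lia.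
ring.
Qed.

Let rod_rec1 k :
  (rod k.+1)^`() = ('X * (rod k)^`() + rod k *+ k.+1) *+ (k.+1).*2.
Proof.
rewrite /rod -derivnS derivSn deriv_sqrXB1_exp derivnMX !derivnMn mulrnAr.
by rewrite [RHS]mulrnDl -[in RHS]derivnS [in RHS]mulrnAC.
Qed.

Let rod_rec2 k : (rod k.+2)^`() =
  rod k.+1 *+ (2 * k.+2 * (2 * k.+1 + 1)) + (rod k)^`() *+ (4 * k.+1 * k.+2).
Proof.
by rewrite /rod -!derivnS 2!derivSn deriv2_sqrXB1_exp derivnD !derivnMn.
Qed.

Let legendreE k : P k = (2 ^+ k * k`!%:R)^-1 *: rod k.
Proof. by []. Qed.

(** The constant of degree k becomes an integer multiple of that of degree k + 1, so each recurrence
    keeps a single scalar [c] and the rest is integer arithmetic. *)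
Let coefS k :
  (2 ^+ k * k`!%:R)^-1 = ((k.+1).*2)%:R * (2 ^+ k.+1 * (k.+1)`!%:R)^-1 :> R.
Proof.
rewrite exprS factS natrM -muln2 natrM; field.
by rewrite nat1r expf_eq0 !pnatr_eq0 -!lt0n fact_gt0 /= andbF.
Qed.

Lemma legendre0 : P 0 = 1.
Proof. by rewrite legendreE /rod expr0 derivn0 fact0 mul1r invr1 scale1r. Qed.

Lemma legendre1 : P 1 = 'X.
Proof.
have fact1 : (1`! = 1)%N by [].
rewrite legendreE /rod !expr1 derivn1 deriv_sqrXB1 fact1 mulr1.
rewrite -[X in _ *: X]scaler_nat scalerA.
by rewrite mulVf ?scale1r// pnatr_eq0.
Qed.

Lemma deriv_legendreS k : (P k.+1)^`() = 'X * (P k)^`() + P k *+ k.+1.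
Proof.
rewrite (legendreE k) (legendreE k.+1) !derivZ rod_rec1 (coefS k).
move: ((_ * _)^-1) => c.
rewrite !mulr_natl -!scalerMnl -!scalerMnr scalerDr scalerAr -scalerMnr; ring.
Qed.

Lemma deriv_legendreSS k :
  (P k.+2)^`() = P k.+1 *+ (2 * k.+1 + 1) + (P k)^`().
Proof.
rewrite (legendreE k) (legendreE k.+1) (legendreE k.+2) !derivZ rod_rec2.
rewrite (coefS k) (coefS k.+1); move: ((_ * _)^-1) => c.
rewrite !mulr_natl -!scalerMnl scalerDr -!scalerMnr -!muln2; ring.
Qed.

Lemma legendre_deriv_pred k : 'X * (P k.+1)^`() = (P k)^`() + P k.+1 *+ k.+1.
Proof.
have := deriv_legendreS k.+1; rewrite deriv_legendreSS => h.
have -> : 'X * (P k.+1)^`() = 'X * (P k.+1)^`() + P k.+1 *+ k.+2 - P k.+1 *+ k.+2.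
  by rewrite addrK.
rewrite -h; ring.
Qed.

Lemma legendre_deriv_weight k :
  (1 - 'X ^+ 2) * (P k.+1)^`() = (P k - 'X * P k.+1) *+ k.+1.
Proof.
have -> : (1 - 'X ^+ 2) * (P k.+1)^`() =
  (P k.+1)^`() - 'X * ('X * (P k.+1)^`()) by ring.
rewrite legendre_deriv_pred {1}deriv_legendreS; ring.
Qed.

Lemma legendre_ode k :
  ((1 - 'X ^+ 2) * (P k)^`())^`() = - (P k *+ (k * k.+1)).
Proof.
case: k => [|k]; first by rewrite legendre0 -[1]/(1%:P) derivC mulr0 deriv0 oppr0.
rewrite legendre_deriv_weight derivMn derivB derivM derivX mul1r.
rewrite legendre_deriv_pred; ring.
Qed.

Lemma legendre_bonnet k :
  P k.+2 *+ k.+2 = ('X * P k.+1) *+ (2 * k.+1 + 1) - P k *+ k.+1.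
Proof.
(* Comparing two expressions of (1 - X^2) P_(k+2)' and eliminating P_(k+1)' yields the identity
   multiplied by X. *)
apply: (@mulfI _ 'X); first by rewrite polyX_eq0.
have h := legendre_deriv_weight k.+1.
rewrite deriv_legendreS mulrDr in h.
have e : 'X * (P k.+2 *+ k.+2) = P k.+1 *+ k.+2 - (P k.+1 - 'X * P k.+2) *+ k.+2 by ring.
rewrite e -h.
have -> : (1 - 'X^2) * ('X * (P k.+1)^`()) = 'X * ((1 - 'X^2) * (P k.+1)^`()) by ring.
rewrite legendre_deriv_weight; ring.
Qed.

Lemma legendre_deriv_weight_at k x : (1 - x ^+ 2) * (P k.+1)^`().[x] =
  k.+1%:R * ((P k).[x] - x * (P k.+1).[x]).
Proof.
have := congr1 (horner^~ x) (legendre_deriv_weight k).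
by move: (P k) (P k.+1) => p q; rewrite /= hornerMn !hornerE mulr_natl.
Qed.

(** The weight 1 - x^2 vanishes at 1, so [legendre_deriv_weight_at] forces P_(k+1)(1) = P_k(1). *)
Lemma legendre_at1 k : (P k).[1] = 1.
Proof.
elim: k => [|k IH]; first by rewrite legendre0 hornerC.
have := legendre_deriv_weight_at k 1; rewrite expr1n subrr mul0r mul1r IH.
by move/esym/eqP; rewrite mulf_eq0 pnatr_eq0 /= subr_eq0 => /eqP.
Qed.

Lemma legendre_atN1 k : (P k).[-1] = (-1) ^+ k.
Proof.
elim: k => [|k IH]; first by rewrite legendre0 hornerC.
have := legendre_deriv_weight_at k (-1).
rewrite sqrrN expr1n subrr mul0r mulN1r opprK IH.
by move/esym/eqP; rewrite mulf_eq0 pnatr_eq0 /= addrC addr_eq0 exprS mulN1r => /eqP.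
Qed.

Lemma legendreSS_at0 k : (P k.+2).[0] * k.+2%:R = - ((P k).[0] * k.+1%:R).
Proof.
have := congr1 (horner^~ 0) (legendre_bonnet k).
rewrite /= hornerMn => h; rewrite mulr_natr h.
rewrite hornerD hornerN !hornerMn hornerM hornerX mul0r mul0rn add0r.
by rewrite mulr_natr.
Qed.

Lemma deriv_legendre_at0 k : (P k.+1)^`().[0] = k.+1%:R * (P k).[0].
Proof.
rewrite deriv_legendreS hornerD hornerM hornerX mul0r add0r hornerMn.
by rewrite mulr_natl.
Qed.

Lemma deriv_legendre_kernel k :
  (P k.+2 - P k)^`() = P k.+1 *+ (2 * k.+1 + 1).
Proof. by rewrite derivB deriv_legendreSS addrK. Qed.

(** Turns the kernel, a primitive of a multiple of P_(k+1), into a multiple of (1 - x^2) P_(k+1)',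
    the quantity that Sonin's method controls. *)
Lemma legendre_kernel_weight k :
  (P k.+2 - P k) *+ (k.+1 * k.+2) = - ((1 - 'X ^+ 2) * (P k.+1)^`()) *+ (2 * k.+1 + 1).
Proof.
rewrite legendre_deriv_weight.
have -> : (P k.+2 - P k) *+ (k.+1 * k.+2) =
  (P k.+2 *+ k.+2 - P k *+ k.+2) *+ k.+1 by ring.
rewrite legendre_bonnet; ring.
Qed.
End legendre_algebra.

(** * Pointwise bounds *)

Section legendre_pointwise_bounds.
Variable R : realType.

Lemma derive_ge0_le (f df : R -> R) (a b : R) : a <= b ->
  (forall x : R, a <= x <= b -> is_derive x 1 f (df x)) ->
  (forall x : R, a < x < b -> 0 <= df x) -> f a <= f b.
Proof.
rewrite le_eqVlt => /predU1P[->//|ab] fdf df0.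
have [||c cab e] := @MVT R f df a b ab.
- by move=> x; rewrite in_itv/= => /andP[xa xb]; apply: fdf; rewrite !ltW.
- apply: continuous_in_subspaceT => x; rewrite inE/= in_itv/= => xab.
  by apply: differentiable_continuous; apply/derivable1_diffP; case: (fdf x xab).
by rewrite -subr_ge0 e mulr_ge0 ?subr_ge0 ?(ltW ab)// df0.
Qed.

Lemma derive_sign_max_at0 (f df : R -> R) :
  (forall x : R, -1 <= x <= 1 -> is_derive x 1 f (df x)) ->
  (forall x : R, -1 <= x <= 1 -> x * df x <= 0) ->
  forall x : R, -1 <= x <= 1 -> f x <= f 0.
Proof.
move=> fdf xdf x /andP[x1 x2].
have [x0|x0] := leP 0 x.
  rewrite -lerN2; apply: (@derive_ge0_le (\- f) (\- df) 0 x x0) => y /andP[y0 yx].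
    have ? : is_derive y 1 f (df y) by apply: fdf; lra.
    exact: is_deriveN.
  rewrite /= oppr_ge0 -(pmulr_rle0 _ y0); apply: xdf; lra.
apply: (@derive_ge0_le f df x 0 (ltW x0)) => y /andP[y0 yx].
  by apply: fdf; lra.
rewrite -(nmulr_rle0 _ yx); apply: xdf; lra.
Qed.

(** * Wallis' product and the values P_k(0) *)

Section wallis.
(* Only the antiderivatives of the powers of sin are needed for Wallis' product;
   the recursion is the usual reduction formula. *)
Fixpoint sin_prim (n : nat) (x : R) : R :=
  match n with
  | 0 => x
  | 1 => 1 - cos x
  | (n'.+1 as n'').+1 =>
      (n''%:R * sin_prim n' x - cos x * sin x ^+ n'') / n''.+1%:R
  end.

Lemma sin_primSS n x : sin_prim n.+2 x =
  (n.+1%:R * sin_prim n x - cos x * sin x ^+ n.+1) / n.+2%:R.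
Proof. by []. Qed.

Lemma is_derive_sin_prim n (x : R) : is_derive x 1 (sin_prim n) (sin x ^+ n).
Proof.
suff : is_derive x 1 (sin_prim n) (sin x ^+ n) /\
  is_derive x 1 (sin_prim n.+1) (sin x ^+ n.+1) by case.
elim: n => [|n [IH1 IH2]].
  split; first by rewrite expr0; exact: is_derive_id.
  have -> : sin_prim 1 = cst 1 - cos by [].
  by apply: is_derive_eq; rewrite sub0r opprK expr1.
split; first exact: IH2.
have -> : sin_prim n.+2 =
   (n.+2%:R)^-1 *: (n.+1%:R *: sin_prim n - cos * (sin ^+ n.+1)).
  by apply/funext => y; rewrite sin_primSS mulrC !fctE.
apply: is_derive_eq.
rewrite !fctE /GRing.scale /= !exprS.
have c2 : cos x * cos x = 1 - sin x * sin x.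
  by rewrite -!expr2 -(cos2Dsin2 x) addrK.
move: (sin x) (cos x) (sin x ^+ n) c2 => s c sn c2.
have -> : c * (n.+1%:R * sn * c) = n.+1%:R * sn * (1 - s * s) by rewrite -c2; ring.
rewrite -(natr1 n.+1); field.
by rewrite nat1r natr1 pnatr_eq0.
Qed.

Lemma sin_prim_at0 n : sin_prim n 0 = 0.
Proof.
suff : sin_prim n 0 = 0 /\ sin_prim n.+1 0 = 0 by case.
elim: n => [|n [IH1 IH2]]; first by rewrite /= cos0 subrr.
by split => //; rewrite sin_primSS IH1 sin0 expr0n !mulr0 subrr mul0r.
Qed.

(** As [sin_prim n] vanishes at 0, this is the integral of sin^n over [0, pi/2]. *)
Definition wallis n := sin_prim n (pi / 2).

Lemma wallisSS n : wallis n.+2 = n.+1%:R / n.+2%:R * wallis n.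
Proof. by rewrite /wallis sin_primSS cos_pihalf mul0r subr0 mulrAC. Qed.

Lemma wallis_ge0 n : 0 <= wallis n.
Proof.
rewrite -(sin_prim_at0 n); apply: (@derive_ge0_le _ (fun x => sin x ^+ n)).
- by rewrite divr_ge0 ?pi_ge0.
- by move=> x _; exact: is_derive_sin_prim.
- move=> x /andP[x0 x1]; apply/exprn_ge0/sin_ge0_pi.
  by have := @pi_ge0 R; lra.
Qed.

Lemma wallis_le n : wallis n.+1 <= wallis n.
Proof.
rewrite -subr_ge0.
have := @derive_ge0_le (sin_prim n - sin_prim n.+1) (fun x =>
  sin x ^+ n - sin x ^+ n.+1) 0 (pi / 2).
rewrite !fctE !sin_prim_at0 subrr; apply.
- by rewrite divr_ge0 ?pi_ge0.
- move=> x _; have ? := is_derive_sin_prim; exact: is_deriveB.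
- move=> x /andP[x0 x1]; rewrite exprS subr_ge0.
  have s0 : 0 <= sin x by apply/sin_ge0_pi; have := @pi_ge0 R; lra.
  by rewrite ler_piMl ?exprn_ge0// sin_le1.
Qed.

(** The factor (n + 1) / (n + 2) of the recursion cancels, so the product keeps its value at n =
    0. *)
Lemma wallis_mul n : n.+1%:R * (wallis n.+1 * wallis n) = pi / 2.
Proof.
elim: n => [|n IH]; first by rewrite /wallis /= cos_pihalf; ring.
rewrite wallisSS -IH; field.
by rewrite -natrD pnatr_eq0.
Qed.

(** Up to sign, P_k(0) obeys the two-step recursion of the Wallis integrals. The two sides agree at
    k = 0, and P_1(0) = 0; squaring removes the alternating sign. *)
Lemma legendre_at0_wallis k :
  (legendre R k).[0] ^+ 2 <= (2 / pi * wallis k) ^+ 2.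
Proof.
have pi0 := @pi_gt0 R.
suff : (legendre R k).[0] ^+ 2 <= (2 / pi * wallis k) ^+ 2 /\
  (legendre R k.+1).[0] ^+ 2 <= (2 / pi * wallis k.+1) ^+ 2 by case.
elim: k => [|k [IH1 IH2]].
  rewrite legendre0 legendre1 hornerC hornerX expr0n /= sqr_ge0; split=> //.
  rewrite /wallis/= (_ : 2 / pi * (pi / 2) = 1) //; field; lra.
split=> //.
have -> : (legendre R k.+2).[0] = - ((k.+1%:R / k.+2%:R) * (legendre R k).[0]).
  have := legendreSS_at0 R k => /(canRL (mulfK _)) -> //.
    by rewrite mulNr [in RHS]mulrC mulrA.
rewrite sqrrN wallisSS (mulrCA (2 / pi)) exprMn [leRHS]exprMn.
by rewrite ler_wpM2l// sqr_ge0.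
Qed.

Lemma legendre_at0_le k : k%:R * (legendre R k).[0] ^+ 2 <= 2 / pi.
Proof.
have pi0 := @pi_gt0 R.
case: k => [|k]; first by rewrite mul0r divr_ge0// ltW.
apply: le_trans (_ : k.+1%:R * (2 / pi * wallis k.+1) ^+ 2 <= _).
  by rewrite ler_wpM2l// legendre_at0_wallis.
(* One factor W_(k+1) is enlarged to W_k to reach the product that [wallis_mul] evaluates. *)
apply: le_trans (_ : (2 / pi) ^+ 2 * (k.+1%:R * (wallis k.+1 * wallis k)) <= _).
  rewrite exprMn mulrCA ler_wpM2l ?sqr_ge0// ler_wpM2l// expr2.
  by rewrite ler_wpM2l ?wallis_ge0 ?wallis_le.
rewrite wallis_mul (_ : _ * _ = 2 / pi) //; field; lra.
Qed.
End wallis.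

Lemma legendre_at0_mulS k : (legendre R k).[0] * (legendre R k.+1).[0] = 0.
Proof.
elim: k => [|k IH]; first by rewrite legendre1 hornerX mulr0.
apply: (@mulIf _ k.+2%:R); first by rewrite pnatr_eq0.
rewrite mul0r -mulrA legendreSS_at0 mulrN mulrA.
by rewrite [X in X * _]mulrC IH mul0r oppr0.
Qed.

(** The left side is P_n^2 + A^2 / D at 0, in the notation of [legendre_bernstein]. By parity only
    one of its two terms is nonzero. *)
Lemma legendre_energy_at0 n : (1 < n)%N ->
  (legendre R n).[0] ^+ 2 + 4 * (legendre R n)^`().[0] ^+ 2 / ((2 * n%:R + 1) ^+ 2 + 1)
  <= 2 / pi / (n%:R - 2^-1).
Proof.
case: n => [|[|k]] // _; set n := k.+2.
have pi0 := @pi_gt0 R.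
have n2 : 2 <= n%:R :> R by rewrite ler_nat.
have hk : k.+1%:R = n%:R - 1 :> R by rewrite /n -[in RHS]natr1 addrK.
have := legendre_at0_le k.+1; have := legendre_at0_le n.
rewrite deriv_legendre_at0 -/n hk.
have := legendre_at0_mulS k.+1; rewrite -/n => /eqP; rewrite mulf_eq0 => /orP[]/eqP ->.
  move=> h _; rewrite mulr0 expr0n/= mulr0 mul0r addr0.
  rewrite ler_pdivlMr ?mulrBr; last lra.
  apply: le_trans h; rewrite [X in X - _]mulrC lerBlDr lerDl.
  by rewrite divr_ge0 ?sqr_ge0.
move=> _; rewrite expr0n/= add0r.
set q := (legendre R k.+1).[0] ^+ 2 => h.
have -> : (n%:R * (legendre R k.+1).[0]) ^+ 2 = n%:R ^+ 2 * q by rewrite exprMn.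
have q0 : 0 <= q by rewrite sqr_ge0.
move: n%:R n2 h => x n2 h.
rewrite ler_pdivlMr; last lra.
apply: le_trans h.
rewrite mulrAC ler_pdivrMr; last nra.
have -> : 4 * (x ^+ 2 * q) * (x - 2^-1) = q * (4 * x ^+ 2 * (x - 2^-1)) by ring.
have -> : (x - 1) * q * ((2 * x + 1) ^+ 2 + 1) =
  q * ((x - 1) * ((2 * x + 1) ^+ 2 + 1)) by ring.
(* The polynomial inequality 4 x^2 (x - 1/2) <= (x - 1) ((2x + 1)^2 + 1) reduces to x^2 >= x + 1,
   which holds for x >= 2 and fails for x = 1. *)
by rewrite ler_wpM2l//; nra.
Qed.

(* Sonin's function for Bernstein's inequality: with Y = 1 - x^2,
   D = (2n + 1)^2 Y + 1 and A = x P_n - 2 Y P_n', the quantity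
   Y (P_n^2 + A^2 / D)^2 dominates Y P_n^4 and is maximal at 0. *)
Lemma legendre_bernstein n (x : R) : (1 < n)%N -> -1 <= x <= 1 ->
  (1 - x ^+ 2) * (legendre R n).[x] ^+ 4 <= (2 / pi / (n%:R - 2^-1)) ^+ 2.
Proof.
move=> n1 x1.
apply: le_trans (_ : ((legendre R n).[0] ^+ 2 +
  4 * (legendre R n)^`().[0] ^+ 2 / ((2 * n%:R + 1) ^+ 2 + 1)) ^+ 2 <= _); last first.
  have h := legendre_energy_at0 n n1.
  set e := (X in X ^+ 2 <= _); have e0 : 0 <= e.
    rewrite addr_ge0 ?sqr_ge0// divr_ge0//.
      by rewrite mulr_ge0 ?sqr_ge0.
  by rewrite lerXn2r// nnegrE (le_trans e0 h).
set p := legendre R n.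
have cE : ((2 * n%:R + 1) ^+ 2)%:P = (2 * n%:R + 1) ^+ 2 :> {poly R}.
  by rewrite rmorphXn rmorphD rmorphM /= !polyC_natr polyC1.
set c : R := (2 * n%:R + 1) ^+ 2 in cE *.
have c0 : 0 <= c by rewrite sqr_ge0.
pose Y : {poly R} := 1 - 'X ^+ 2.
pose D : {poly R} := c%:P * Y + 1.
pose A : {poly R} := 'X * p - 2%:R%:P * Y * p^`().
pose M : {poly R} := p ^+ 2 * D + A ^+ 2.
pose N : {poly R} := Y * M ^+ 2.
have dY : Y^`() = - 'X *+ 2.
  by rewrite /Y derivB derivXn -[1]/(1%:P) derivC /= expr1 sub0r mulNrn.
have ode : Y * p^`()^`() = 'X * p^`() *+ 2 - p *+ (n * n.+1).
  have := legendre_ode R n; rewrite -/p -/Y derivM dY => /(canRL (addKr _)) ->; ring.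
have dD : D^`() = - c%:P * 'X *+ 2.
  by rewrite /D derivD derivM derivC mul0r add0r dY -[1]/(1%:P) derivC addr0; ring.
have dA : A^`() = p *+ (2 * (n * n.+1) + 1) + 'X * p^`().
  rewrite /A derivB derivM derivX mul1r -mulrA derivM derivC mul0r add0r derivM dY ode.
  rewrite (_ : 2%:R%:P = 2) ?polyC_natr//; ring.
have dM : M^`() = p * p^`() * D *+ 2 + p ^+ 2 * D^`() + A * A^`() *+ 2.
  rewrite /M derivD !expr2 !derivM; ring.
(* Numerator of the derivative of N / D^2. Once the differential equation has removed P_n'', it is
   -4x times factors that are nonnegative on [-1, 1], where D >= 1; hence the maximum at 0. *)
have key : N^`() * D ^+ 2 - N * (D ^+ 2)^`() = - (4%:R * 'X * M * A ^+ 2 * D).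
  have -> : N^`() * D ^+ 2 - N * (D ^+ 2)^`() =
      D * M * (Y^`() * M * D + 2 * Y * M^`() * D - 2 * Y * M * D^`()).
    rewrite /N derivM !expr2 !derivM; ring.
  suff -> : Y^`() * M * D + 2 * Y * M^`() * D - 2 * Y * M * D^`() = - (4 * 'X * A ^+ 2).
    ring.
  rewrite dY dM dD dA /M /A /D /Y cE (_ : 2%:R%:P = 2) ?polyC_natr//; ring.
have DE y : D.[y] = c * (1 - y ^+ 2) + 1.
  by rewrite /D /Y hornerD hornerM hornerC hornerD hornerN hornerXn !hornerC.
have Dgt y : -1 <= y <= 1 -> 1 <= D.[y].
  move=> /andP[y1 y2]; rewrite DE lerDr mulr_ge0//; nra.
have ME y : M.[y] = p.[y] ^+ 2 * D.[y] + A.[y] ^+ 2.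
  by rewrite /M hornerD hornerM !horner_exp.
have NE y : N.[y] = (1 - y ^+ 2) * M.[y] ^+ 2.
  by rewrite /N hornerM horner_exp /Y hornerD hornerN hornerXn hornerC.
have AE y : A.[y] = y * p.[y] - 2 * (1 - y ^+ 2) * p^`().[y].
  by rewrite /A hornerD hornerN !hornerM hornerX hornerC /Y hornerD hornerN hornerXn
    hornerC.
have fE y : -1 <= y <= 1 -> N.[y] * ((D ^+ 2).[y])^-1 =
    (1 - y ^+ 2) * (p.[y] ^+ 2 + A.[y] ^+ 2 / D.[y]) ^+ 2.
  move=> /Dgt D1; rewrite NE ME horner_exp; field; lra.
have := @derive_sign_max_at0 (fun y => N.[y] * ((D ^+ 2).[y])^-1)
  (fun y => (N^`() * D ^+ 2 - N * (D ^+ 2)^`()).[y] / ((D ^+ 2).[y]) ^+ 2) _ _ x x1.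
rewrite !fE//; last lra.
have -> : (1 - 0 ^+ 2) * (p.[0] ^+ 2 + A.[0] ^+ 2 / D.[0]) ^+ 2 =
  (p.[0] ^+ 2 + 4 * p^`().[0] ^+ 2 / (c + 1)) ^+ 2.
  by rewrite DE AE expr0n/= subr0 !mul1r !mulr1 mul0r sub0r sqrrN exprMn (_ : 2 ^+ 2
    = 4)//; ring.
move=> h; apply: le_trans (h _ _).
- rewrite ler_wpM2l//; first by nra.
  have -> : p.[x] ^+ 4 = (p.[x] ^+ 2) ^+ 2 by rewrite -exprM.
  have q0 : 0 <= A.[x] ^+ 2 / D.[x].
    by rewrite divr_ge0 ?sqr_ge0// (le_trans _ (Dgt _ x1)).
  by rewrite lerXn2r ?nnegrE ?addr_ge0 ?sqr_ge0// lerDl.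
- move=> y y1.
  have D20 : (D ^+ 2).[y] != 0 by rewrite horner_exp expf_eq0 /=; have := Dgt _ y1; lra.
  have d1 := is_derive_poly N y.
  have d2 := is_deriveV D20 (is_derive_poly (D ^+ 2) y).
  have := is_deriveM d1 d2.
  move/(is_derive_eq); apply.
  rewrite /GRing.scale/= hornerD hornerN (hornerM N^`()) (hornerM N).
  have quot (e a b d : R) : e != 0 ->
      a * (- e ^- 2 * b) + e^-1 * d = (d * e - a * b) / e ^+ 2.
    by move=> e0; field.
  exact: quot.
- move=> y y1; rewrite key hornerN mulNr mulrN oppr_le0 mulrA divr_ge0 ?sqr_ge0//.
  have D0 : 0 <= D.[y] by rewrite (le_trans _ (Dgt _ y1)).
  have M0 : 0 <= M.[y] by rewrite ME addr_ge0 ?sqr_ge0// mulr_ge0 ?sqr_ge0.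
  rewrite -polyC_natr !hornerM hornerC hornerX.
  have -> : y * (4%:R * y * M.[y] * (A.[y] * A.[y]) * D.[y]) =
    y ^+ 2 * 4%:R * M.[y] * A.[y] ^+ 2 * D.[y] by ring.
  by do ![apply: sqr_ge0 | apply: mulr_ge0 => //].
Qed.

(* Here Sonin's function is u^2 + n (n + 1) (1 - x^2) P_n^2 with
   u = (1 - x^2) P_n' and n = k + 1. *)
Lemma legendre_kernel_le k (x : R) : -1 <= x <= 1 ->
  (((legendre R k.+2).[x] - (legendre R k).[x]) / 2) ^+ 2 <=
  2 / pi / (k.+1%:R - 2^-1).
Proof.
move=> x1; set p := legendre R k.+1.
have pi0 := @pi_gt0 R.
pose S : {poly R} := ((1 - 'X ^+ 2) * p^`()) ^+ 2 +
   (1 - 'X ^+ 2) * p ^+ 2 *+ (k.+1 * k.+2).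
have dS : S^`() = - 'X * p ^+ 2 *+ (2 * (k.+1 * k.+2)).
  rewrite /S derivD expr2 derivM legendre_ode derivMn derivM.
  rewrite derivB derivXn -[1]/(1%:P) derivC /= expr1 expr2 derivM -/p; ring.
have SE y : S.[y] = ((1 - y ^+ 2) * p^`().[y]) ^+ 2 +
    k.+1%:R * k.+2%:R * ((1 - y ^+ 2) * p.[y] ^+ 2).
  rewrite /S hornerD horner_exp hornerMn -mulr_natr natrM.
  rewrite !hornerM hornerD hornerN hornerXn hornerC; ring.
have : S.[x] <= S.[0].
  apply: (@derive_sign_max_at0 (fun y => S.[y]) (fun y => S^`().[y])) => [y _|y _|//].
    exact: is_derive_poly.
  rewrite dS hornerMn hornerM hornerN hornerX -mulr_natr horner_exp.
  have -> : y * (- y * p.[y] ^+ 2 * (2 * (k.+1 * k.+2))%:R) =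
    - (y ^+ 2 * p.[y] ^+ 2 * (2 * (k.+1 * k.+2))%:R) by ring.
  by rewrite oppr_le0 mulr_ge0 ?ler0n// mulr_ge0 ?sqr_ge0.
have hq := congr1 (horner^~ x) (legendre_kernel_weight R k).
rewrite /= in hq.
have {}hq : ((legendre R k.+2).[x] - (legendre R k).[x]) * (k.+1%:R * k.+2%:R) =
   - ((1 - x ^+ 2) * p^`().[x]) * (2 * k.+1%:R + 1).
  move: hq; rewrite -/p; move: (legendre R k.+2) (legendre R k) p^`() => a b e.
  rewrite !hornerMn hornerD !hornerN hornerM hornerD hornerN hornerXn hornerC.
  by rewrite -[X in X = _ -> _]mulr_natr -[X in _ = X -> _]mulr_natr natrM natrD natrM.
have n1 : 1 <= k.+1%:R :> R by rewrite ler1n.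
have nS : k.+2%:R = k.+1%:R + 1 :> R by rewrite natr1.
rewrite !SE expr0n/= subr0 !mul1r deriv_legendre_at0.
set u := (1 - x ^+ 2) * p^`().[x] in hq *.
set q := (legendre R k.+2).[x] - (legendre R k).[x] in hq *.
have P0 : 0 <= (1 - x ^+ 2) * p.[x] ^+ 2 by rewrite mulr_ge0 ?sqr_ge0//; nra.
rewrite nS in hq *; set n : R := k.+1%:R in n1 nS hq *.
set z := (legendre R k).[0]; set w := p.[0].
move=> uS; have {}uS : u ^+ 2 <= n ^+ 2 * z ^+ 2 + n * (n + 1) * w ^+ 2.
  by rewrite -exprMn (le_trans _ uS)// lerDl mulr_ge0// mulr_ge0; lra.
have {hq} -> : (q / 2) ^+ 2 = u ^+ 2 * ((n + 2^-1) / (n * (n + 1))) ^+ 2.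
  have -> : q = - u * (2 * n + 1) / (n * (n + 1)).
    by rewrite -hq mulfK// mulf_neq0; lra.
  by field; lra.
set t := 2 / pi.
have t0 : 0 <= t by rewrite divr_ge0// ltW.
apply: le_trans (_ : (n ^+ 2 * z ^+ 2 + n * (n + 1) * w ^+ 2) * ((n +
  2^-1) / (n * (n + 1))) ^+ 2 <= _).
  by rewrite ler_wpM2r ?sqr_ge0.
rewrite ler_pdivlMr; last lra.
have -> : (n ^+ 2 * z ^+ 2 + n * (n + 1) * w ^+ 2) * ((n + 2^-1) / (n * (n +
  1))) ^+ 2 * (n - 2^-1) =
  z ^+ 2 * ((n + 2^-1) ^+ 2 * (n - 2^-1) / (n + 1) ^+ 2) + w ^+ 2 * ((n +
    2^-1) ^+ 2 * (n - 2^-1) / (n * (n + 1))).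
  field; lra.
have hA : z = 0 -> z ^+ 2 * ((n + 2^-1) ^+ 2 * (n - 2^-1) / (n + 1) ^+ 2) +
   w ^+ 2 * ((n + 2^-1) ^+ 2 * (n - 2^-1) / (n * (n + 1))) <= t.
  move=> ->; rewrite expr0n/= mul0r add0r.
  apply: le_trans (legendre_at0_le k.+1);
    rewrite -/p -/w -/n [leRHS]mulrC ler_wpM2l ?sqr_ge0//.
  rewrite ler_pdivrMr; nra.
(* By parity z = 0 or w = 0, and [hA] settles z = 0. For w = 0 the bound k z^2 <= 2 / pi is enough
   only from n = 3 on; n = 2 has z = P_1(0) = 0, and n = 1 is the numerical inequality 9/32 <= 2 /
   pi. *)
case: k @p @S dS SE @u @q P0 @n n1 nS @z @w hA uS =>
  [|[|k]] p S dS SE u q P0 n n1 nS z w hA uS.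
- rewrite /w /p legendre1 hornerX expr0n/= mul0r addr0 /z legendre0 hornerC expr1n
  mul1r /n.
  rewrite /t ler_pdivlMr//.
  rewrite (_ : (1 + 2^-1) ^+ 2 * (1 - 2^-1) / (1 + 1) ^+ 2 = 9 / 32); last by field.
  by have := pihalf_lt2 R; lra.
- by apply: hA; rewrite /z legendre1 hornerX.
- have := legendre_at0_mulS k.+2; rewrite -/p -/w -/z => /eqP;
  rewrite mulf_eq0 => /orP[/eqP/hA//|/eqP ->].
  rewrite expr0n/= mul0r addr0.
  apply: le_trans (legendre_at0_le k.+2); rewrite -/z [leRHS]mulrC ler_wpM2l ?sqr_ge0//.
  have -> : k.+2%:R = n - 1 :> R by rewrite /n -[in RHS]natr1 addrK.
  have n3 : 3 <= n by rewrite /n ler_nat.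
  rewrite ler_pdivrMr; nra.
Qed.
End legendre_pointwise_bounds.

(** * Absolutely continuous functions *)

Set Implicit Arguments.
Unset Strict Implicit.
Unset Printing Implicit Defensive.

Section absolute_continuity.
Variable R : realType.
Local Notation mu := (@lebesgue_measure R).
Implicit Types (a b : R) (f h : R -> R).

(** Differentiability at x relative to A, written without division: one-sided derivatives at the
    endpoints are included, y = x needs no exception, and sums and products are handled by plain
    estimates. *)
Definition linearized_on (A : set R) f (x l : R) :=
  forall e : R, 0 < e -> exists2 d : R, 0 < d &
    forall y : R, A y -> `|y - x| < d -> `|f y - f x - l * (y - x)| <= e * `|y - x|.

Lemma is_derive_on_linearized (A : set R) f (x l : R) :
  is_derive_on A f x l -> linearized_on A f x l.
Proof.
move=> fl e e0; move/cvgrPdist_le : fl => /(_ e e0).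
rewrite near_withinE near_withinE => /nbhs_ballP[d /= d0 H].
exists d => // y Ay yx.
have [->|yneqx] := eqVneq y x; first by rewrite !subrr mulr0 subr0 normr0 mulr0.
have := H y; rewrite /ball/= distrC yx => /(_ isT yneqx Ay).
have yx0 : y - x != 0 by rewrite subr_eq0.
rewrite /diff_quotient distrC => h.
have -> : f y - f x - l * (y - x) = ((f y - f x) / (y - x) - l) * (y - x).
  by rewrite mulrBl divfK.
by rewrite normrM ler_wpM2r.
Qed.

Lemma is_derive_linearized (A : set R) f (x l : R) :
  is_derive x 1 f l -> linearized_on A f x l.
Proof.
move=> /is_derive1_caratheodory[g [fg cg gl]] e e0.
move/cvgrPdist_le : cg => /(_ e e0) /nbhs_ballP[d /= d0 H].
exists d => // y Ay yx; rewrite fg -gl -mulrBl normrM ler_wpM2r// distrC.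
by apply: H; rewrite /ball/= distrC.
Qed.

Lemma linearized_onB (A : set R) f h (x l k : R) :
  linearized_on A f x l -> linearized_on A h x k ->
  linearized_on A (f \- h) x (l - k).
Proof.
move=> fl hk e e0; have e2 : 0 < e / 2 by rewrite divr_gt0.
have [d d0 fd] := fl _ e2; have [c c0 hc] := hk _ e2.
exists (Order.min d c); first by rewrite lt_min d0.
move=> y Ay; rewrite lt_min => /andP[yd yc].
have -> : (f \- h) y - (f \- h) x - (l - k) * (y - x) =
  (f y - f x - l * (y - x)) - (h y - h x - k * (y - x)) by rewrite /=; ring.
apply: (le_trans (ler_normB _ _)).
by rewrite [leRHS](_ : _ = e / 2 * `|y - x| + e / 2 * `|y - x|) ?lerD ?fd ?hc//; field.
Qed.

Lemma linearized_onM (A : set R) f h (x l k : R) :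
  linearized_on A f x l -> linearized_on A h x k ->
  linearized_on A (f \* h) x (l * h x + f x * k).
Proof.
move=> fl hk e e0.
(* The three summands are the factors of e' t in the estimates of the two linear remainders and of
   the product of the increments; the latter is quadratic in t, and t < e' makes it small. *)
pose M := `|h x| + `|f x| + (`|l| + 1) * (`|k| + 1).
have M0 : 0 < M by rewrite /M ltr_wpDl// mulr_gt0// ltr_wpDl.
pose e' := Order.min 1 (e / (2 * M)).
have e'0 : 0 < e' by rewrite lt_min ltr01 divr_gt0// mulr_gt0.
have e'1 : e' <= 1 by rewrite ge_min lexx.
have e'e : M * e' <= e / 2.
  have : e' <= e / (2 * M) by rewrite ge_min lexx orbT.
  rewrite ler_pdivlMr ?mulr_gt0// ler_pdivlMr// => ?; lra.
have [d d0 fd] := fl _ e'0; have [c c0 hc] := hk _ e'0.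
exists (Order.min e' (Order.min d c)); first by rewrite lt_min e'0 lt_min d0.
move=> y Ay; rewrite lt_min => /andP[ye]; rewrite lt_min => /andP[yd yc].
have {}fd := fd y Ay yd; have {}hc := hc y Ay yc.
set t := `|y - x| in ye yd yc fd hc *.
have t0 : 0 <= t by rewrite /t.
have hD : `|h y - h x| <= (`|k| + 1) * t.
  have -> : h y - h x = (h y - h x - k * (y - x)) + k * (y - x) by ring.
  apply: (le_trans (ler_normD _ _)); rewrite normrM -/t; nra.
have fD : `|f y - f x| <= (`|l| + 1) * t.
  have -> : f y - f x = (f y - f x - l * (y - x)) + l * (y - x) by ring.
  apply: (le_trans (ler_normD _ _)); rewrite normrM -/t; nra.
have -> : (f \* h) y - (f \* h) x - (l * h x + f x * k) * (y - x) =
  (f y - f x - l * (y - x)) * h x + f x * (h y - h x - k * (y - x)) +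
  (f y - f x) * (h y - h x) by rewrite /=; ring.
apply: (@le_trans _ _ (e' * t * `|h x| + `|f x| * (e' * t) + ((`|l| +
  1) * t) * ((`|k| + 1) * t))).
  apply: (le_trans (ler_normD _ _)); apply: lerD.
    apply: (le_trans (ler_normD _ _)); rewrite !normrM; apply: lerD.
      by rewrite ler_wpM2r.
    by rewrite ler_wpM2l.
  by rewrite normrM ler_pM.
have lk : 0 <= (`|l| + 1) * (`|k| + 1) by rewrite mulr_ge0.
have -> : ((`|l| + 1) * t) * ((`|k| + 1) * t) = (`|l| + 1) * (`|k| + 1) * t * t by ring.
apply: (@le_trans _ _ (M * e' * t)).
  rewrite /M !mulrDl; apply: lerD; first by apply: lerD; lra.
  rewrite -!mulrDl -(mulrA ((`|l| + 1) * (`|k| + 1))) -(mulrA ((`|l| + 1) * (`|k| +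
    1))) ler_wpM2l// ler_wpM2r// ltW//.
apply: ler_wpM2r => //; lra.
Qed.

Lemma absolutely_continuousW a b (c d : R) f : a <= c -> d <= b ->
  absolutely_continuous a b f -> absolutely_continuous c d f.
Proof.
move=> ac db fab e /fab[r r0 H]; exists r => // N u v uv.
by apply: H => i; have [cu [? vd]] := uv i; split; [|split];
  rewrite ?(le_trans ac) ?(le_trans vd).
Qed.

Lemma absolutely_continuousB a b f h :
  absolutely_continuous a b f -> absolutely_continuous a b h ->
  absolutely_continuous a b (f \- h).
Proof.
move=> fab hab e e0; have e2 : 0 < e / 2 by rewrite divr_gt0.
have [r r0 H] := fab _ e2; have [s s0 K] := hab _ e2.
exists (Order.min r s); first by rewrite lt_min r0.
move=> N u v uv tr; rewrite lt_min => /andP[lr ls].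
apply: (@le_lt_trans _ _ (\sum_i (`|f (v i) - f (u i)| + `|h (v i) - h (u i)|))).
  apply: ler_sum => i _ /=.
  rewrite [X in `|X|](_ : _ = f (v i) - f (u i) - (h (v i) - h (u i))); last by ring.
  exact: ler_normB.
rewrite big_split/= [ltRHS](splitr e) ltrD//; [exact: H|exact: K].
Qed.

Lemma lipschitz_absolutely_continuous a b f (C : R) :
  (forall x y, a <= x -> x <= y -> y <= b -> `|f y - f x| <= C * (y - x)) ->
  absolutely_continuous a b f.
Proof.
move=> fC e e0; exists (e / (`|C| + 1)); first by rewrite divr_gt0// ltr_wpDl.
move=> N u v uv _; rewrite ltr_pdivlMr ?ltr_wpDl// => h; apply: le_lt_trans h.
rewrite mulr_suml; apply: ler_sum => i _; have [au [uvi vb]] := uv i.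
apply: (le_trans (fC _ _ au uvi vb)); rewrite mulrC ler_wpM2l ?subr_ge0//.
by rewrite (le_trans (ler_norm _))// lerDl.
Qed.

Lemma absolutely_continuous_dist a b f e : absolutely_continuous a b f -> 0 < e ->
  exists2 d : R, 0 < d & forall x y, a <= x <= b -> a <= y <= b ->
    `|y - x| < d -> `|f y - f x| < e.
Proof.
move=> fab /fab[d d0 H]; exists d => // x y.
wlog xy : x y / x <= y => [hw xab yab|/andP[ax xb] /andP[ay yb] yxd].
  have [xy|/ltW yx] := leP x y; first exact: hw.
  by rewrite [X in X < d]distrC [X in X < e]distrC => ?; exact: hw.
have := H 1%N (fun=> x) (fun=> y); rewrite !big_ord1; apply => //.
- by move=> i j _ _ _; rewrite (ord1 i) (ord1 j).
- by rewrite (le_lt_trans (ler_norm _) yxd).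
Qed.

Lemma absolutely_continuous_within a b f : absolutely_continuous a b f ->
  {within `[a, b], continuous f}.
Proof.
move=> fab; apply/subspace_continuousP => x; rewrite /= in_itv/= => xab.
apply/cvgrPdist_lt => e e0.
have [d d0 H] := absolutely_continuous_dist fab e0.
rewrite near_withinE; apply/nbhs_ballP; exists d => //= y xyd.
by rewrite in_itv/= => yab; apply: H.
Qed.

Lemma absolutely_continuous_bounded a b f : absolutely_continuous a b f ->
  exists C : R, forall x, a <= x <= b -> `|f x| <= C.
Proof.
move=> /absolutely_continuous_within cf.
have /compact_bounded[M [_ HM]] := continuous_compact cf (@segment_compact R a b).
exists (M + 1) => x xab; apply: (HM (M + 1)); first by rewrite ltrDl.
by exists x => //; rewrite /= in_itv.
Qed.

(** A Lipschitz second factor suffices, since f is only ever multiplied by polynomials. *)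
Lemma absolutely_continuousM a b f h (C : R) :
  absolutely_continuous a b f ->
  (forall x y, a <= x -> x <= y -> y <= b -> `|h y - h x| <= C * (y - x)) ->
  absolutely_continuous a b (f \* h).
Proof.
move=> fab hC e e0.
have hab := lipschitz_absolutely_continuous hC.
have [A fA] := absolutely_continuous_bounded fab.
have [B hB] := absolutely_continuous_bounded hab.
pose M := `|A| + `|B| + 1.
have M0 : 0 < M by rewrite ltr_wpDl.
have eM : 0 < e / (2 * M) by rewrite divr_gt0// mulr_gt0.
have [r r0 H] := fab _ eM; have [s s0 K] := hab _ eM.
exists (Order.min r s); first by rewrite lt_min r0.
move=> N u v uv tr; rewrite lt_min => /andP[lr ls].
apply: (@le_lt_trans _ _ (\sum_i (M * `|f (v i) - f (u i)| + M * `|h (v i) - h (u i)|))).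
  apply: ler_sum => i _ /=; have [au [uvi vb]] := uv i.
  have -> : f (v i) * h (v i) - f (u i) * h (u i) =
    h (v i) * (f (v i) - f (u i)) + f (u i) * (h (v i) - h (u i)) by ring.
  apply: (le_trans (ler_normD _ _)); rewrite !normrM; apply: lerD; rewrite ler_wpM2r//.
    rewrite (le_trans (hB _ _)) ?vb ?(le_trans au)//.
    by rewrite (le_trans (ler_norm _))// /M addrAC lerDr addr_ge0.
  rewrite (le_trans (fA _ _)) ?au ?(le_trans uvi)//.
  by rewrite (le_trans (ler_norm _))// /M -addrA lerDl addr_ge0.
rewrite big_split/= -!mulr_sumr -mulrDr mulrC -ltr_pdivlMr//.
rewrite [ltRHS](_ : _ = e / (2 * M) + e / (2 * M)); last by field; lra.
by rewrite ltrD//; [exact: H|exact: K].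
Qed.


(* [chain U a t s]: the closed intervals listed in [s], from right to left, lie
   in [U] and in [[a, t]] and do not overlap. *)
Fixpoint chain (U : set R) a (t : R) (s : seq (R * R)) : Prop :=
  match s with
  | [::] => a <= t
  | p :: s' => [/\ p.1 <= p.2, p.2 <= t, `[p.1, p.2] `<=` U & chain U a p.1 s']
  end.

Lemma chain_le (U : set R) a (t t' : R) s : t <= t' -> chain U a t s -> chain U a t' s.
Proof.
case: s => [|p s] /= tt'; first by move=> /le_trans; exact.
by move=> [? pt ? ?]; split => //; exact: le_trans pt tt'.
Qed.

Lemma chain_bnd (U : set R) a (t : R) s : chain U a t s ->
  a <= t /\ forall p, p \in s -> [/\ a <= p.1, p.1 <= p.2 & p.2 <= t].
Proof.
elim: s t => [|p s IH] t /= => [at_|[p12 p2t pU /IH[ap1 H]]]; first by split.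
split; first exact: le_trans ap1 (le_trans p12 p2t).
move=> q; rewrite inE => /predU1P[->//|/H[aq q12 qp]]; split=> //.
by rewrite (le_trans qp)// (le_trans p12).
Qed.

Lemma chain_pairwise (U : set R) a (t : R) s : chain U a t s ->
  pairwise (fun p q => q.2 <= p.1) s.
Proof.
elim: s t => [//|p s IH] t /= [p12 p2t pU c]; rewrite (IH _ c) andbT.
by apply/allP => q /(proj2 (chain_bnd c))[].
Qed.

(** Half-open intervals are measured because neighbours in a chain may share an endpoint. *)
Lemma chain_length (U : set R) a (t : R) s : measurable U -> chain U a t s ->
  ((\sum_(p <- s) (p.2 - p.1))%:E <= mu (U `&` `[a, t[))%E.
Proof.
move=> mU; elim: s t => [|p s IH] t /=; first by rewrite big_nil.
move=> [p12 p2t pU c]; rewrite big_cons.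
have [ap1 _] := chain_bnd c.
apply: (@le_trans _ _ (mu ((U `&` `[a, p.1[) `|` `[p.1, p.2[))).
  rewrite measureU//=; last 2 first.
  - by apply: measurableI.
  - apply/seteqP; split => x //= [[_]]; rewrite !in_itv/= => /andP[_ xp] /andP[px _].
    by move: (lt_le_trans xp px); rewrite ltxx.
  rewrite addrC EFinD leeD ?IH//.
  rewrite lebesgue_measure_itv/= lte_fin; case: ltP => //.
  by rewrite lee_fin subr_le0.
apply: le_measure; rewrite ?inE.
- by apply: measurableU => //; exact: measurableI.
- exact: measurableI.
- move=> x [[Ux]|]; rewrite /= !in_itv/= => /andP[x1 x2].
    by split => //; rewrite x1 (lt_le_trans x2)// (le_trans p12).
  split; first by apply: pU; rewrite /= in_itv/= x1 ltW.
  by rewrite (le_trans ap1)// (lt_le_trans x2).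
Qed.

(** Absolute continuity with the total length replaced by the measure of a set containing the
    intervals; this suits an open set covering the exceptional points. *)
Lemma chain_absolutely_continuous a b f (e : R) :
  absolutely_continuous a b f -> 0 < e -> exists2 d : R, 0 < d &
  forall (U : set R) s, measurable U -> (mu U < d%:E)%E -> chain U a b s ->
    \sum_(p <- s) `|f p.2 - f p.1| < e.
Proof.
move=> fab /fab[d d0 H]; exists d => // U s mU Ud c.
have [ab sP] := chain_bnd c.
pose u (i : 'I_(size s)) := (nth (0, 0) s i).1.
pose v (i : 'I_(size s)) := (nth (0, 0) s i).2.
have sumE (F : R * R -> R) : \sum_(p <- s) F p = \sum_(i < size s) F (nth (0, 0) s i).
  by rewrite (big_nth (0, 0)) big_mkord.
rewrite sumE; apply: (H (size s) u v).
- by move=> i; have [] := sP _ (mem_nth (0, 0) (ltn_ord i)).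
- have disj (i j : 'I_(size s)) : (i < j)%N -> v j <= u i.
    by move=> ij; have /(pairwiseP (0, 0)) := chain_pairwise c; apply; rewrite ?inE.
  move=> i j _ _ [x []]; rewrite /= !in_itv/= => /andP[ui iv] /andP[uj jv].
  apply/val_inj; case: (ltngtP i j) => // /disj.
    by move=> /(lt_le_trans jv)/lt_trans/(_ ui); rewrite ltxx.
  by move=> /(lt_le_trans iv)/lt_trans/(_ uj); rewrite ltxx.
- rewrite -lte_fin -(sumE (fun p => p.2 - p.1)).
  apply: (le_lt_trans (chain_length mU c)); apply: le_lt_trans Ud.
  by apply: le_measure; rewrite ?inE//; exact: measurableI.
Qed.

(* Real induction: outside the exceptional null set the increments of f are small
   relative to the length; inside it they are collected into a chain of intervals
   lying in an open set of small measure. *)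
Lemma absolutely_continuous_constant a b f : a <= b ->
  absolutely_continuous a b f ->
  {ae mu, forall x, a <= x <= b -> linearized_on `[a, b] f x 0} ->
  f b = f a.
Proof.
move=> ab fab [N [mN N0 fN]].
(* The term e (b - a) pays for the points where f has derivative 0, and the last e for the
   exceptional null set. *)
suff small (e : R) : 0 < e -> `|f b - f a| <= e * (b - a) + e.
  apply/eqP; rewrite -subr_eq0 -normr_le0; apply/ler_addgt0Pr => e e0; rewrite add0r.
  have e1 : 0 < e / (b - a + 1) by rewrite divr_gt0// ltr_wpDl ?subr_ge0.
  apply: (le_trans (small _ e1)); rewrite -[X in _ + X]mulr1 -mulrDr divfK// gt_eqF//.
  by rewrite ltr_wpDl ?subr_ge0.
move=> e0.
have [d d0 Hd] := chain_absolutely_continuous fab e0.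
have [|U [oU NU Ud]] := @lebesgue_regularity_outer R N d mN _ d0.
  by rewrite [X in (X < _)%E]N0.
have mU : measurable U by exact: open_measurable.
have {}Ud : (mu U < d%:E)%E.
  have -> : U = N `|` (U `\` N) by rewrite setDUK.
  rewrite measureU//; [|exact: measurableD|by rewrite setDIK].
  by rewrite [X in (X + _)%E](_ : _ = 0%E)// add0e.
(* The chain is kept explicit so that it can be prolonged; its sum is bounded by e only once, at t =
   b, by the choice of U. *)
pose good t := t <= b /\ exists2 s, chain U a t s &
   `|f t - f a| <= e * (t - a) + \sum_(p <- s) `|f p.2 - f p.1|.
suff [_ [s sc fs]] : good b.
  by apply: (le_trans fs); rewrite lerD2l ltW// (Hd U s).
have ga : good a.
  split=> //; exists [::] => //=; by rewrite big_nil !subrr mulr0 addr0 normr0.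
have gle t : good t -> a <= t by move=> [_ [s /chain_bnd[]]].
(* [good] passes across x, from any nearby t on its left to any nearby t' on its right, with a
   radius depending on x alone. *)
have step x : a <= x <= b -> exists2 r, 0 < r & forall t t', t <= x -> x <=
  t' -> t' <= b ->
    x - r < t -> t' < x + r -> good t -> good t'.
  move=> xab; have [xN|xN] := pselect (N x); last first.
    have {}xN : linearized_on `[a, b] f x 0 by apply: contrapT => h; apply: xN;
      apply: fN => /(_ xab).
    have [r r0 xr] := xN _ e0; exists r => // t t' tx xt' t'b rt t'r gt_.
    have at_ := gle _ gt_; have [tb [s sc fs]] := gt_.
    split=> //; exists s; first by apply: chain_le sc; exact: le_trans xt'.
    have h1 : `|f t - f x| <= e * (x - t).
      have := xr t; rewrite mul0r subr0 [`|t - x|]ler0_norm ?subr_le0// opprB; apply.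
        by rewrite /= in_itv/= at_.
      by lra.
    have h2 : `|f t' - f x| <= e * (t' - x).
      have := xr t'; rewrite mul0r subr0 [`|t' - x|]ger0_norm ?subr_ge0//; apply.
        by rewrite /= in_itv/= t'b (le_trans at_)// (le_trans tx).
      by lra.
    have -> : f t' - f a = (f t' - f x) - (f t - f x) + (f t - f a) by ring.
    apply: (le_trans (ler_normD _ _)).
    have := ler_normB (f t' - f x) (f t - f x); lra.
  have /nbhs_ballP[r r0 xr] : nbhs x U by apply: open_nbhs_nbhs; split => //; exact: NU.
  exists r => // t t' tx xt' t'b rt t'r [_ [s sc fs]]; split => //.
  exists ((t, t') :: s); last first.
    rewrite big_cons/=.
    have -> : f t' - f a = (f t' - f t) + (f t - f a) by ring.
    apply: (le_trans (ler_normD _ _)).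
    have : e * (t - a) <= e * (t' - a) by rewrite ler_wpM2l ?(ltW e0)// lerD2r
      (le_trans tx).
    lra.
  split => //=; first exact: le_trans xt'.
  move=> y; rewrite /= in_itv/= => /andP[ty yt']; apply: xr.
  by rewrite /ball/= ltr_distl; apply/andP; split; lra.
have ubA : has_sup good.
  by split; [exists a|exists b => t []].
pose z := sup good.
have zb : z <= b by apply: ge_sup; [exists a|move=> t []].
have az : a <= z by apply: ub_le_sup => //; exact: ubA.2.
have [|r r0 H] := step z; first by rewrite az.
have [t gt_ zt] := sup_adherent r0 ubA.
(* A good point beyond the supremum z unless b cuts it off; since t' <= z, it is b itself. *)
pose t' := Order.min b (z + r / 2).
have gt' : good t'.
  apply: (H t t') => //; rewrite /t' ?ge_min ?lexx ?le_min//.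
  - by apply: ub_le_sup => //; exact: ubA.2.
  - by rewrite zb lerDl divr_ge0// ltW.
  - by rewrite gt_min ltrD2l gtr_pMr// invf_lt1 ?ltr1n ?orbT.
have : t' <= z by apply: ub_le_sup => //; exact: ubA.2.
rewrite /t' ge_min => /orP[bz|]; last by rewrite gerDl leNgt divr_gt0.
suff -> : b = t' by [].
by apply/eqP; rewrite eq_le /t' ge_min lexx le_min lexx/= (le_trans bz)// lerDl
  divr_ge0// ltW.
Qed.

(** * The fundamental theorem of calculus with a bounded derivative *)

Lemma measure_segment (a b : R) : a <= b -> mu `[a, b] = (b - a)%:E.
Proof.
rewrite lebesgue_measure_itv/= lte_fin le_eqVlt => /predU1P[->|->] //.
by rewrite ltxx subrr.
Qed.

Lemma bounded_integrable (a b : R) h (C : R) : measurable_fun `[a, b] h ->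
  (forall x, a <= x <= b -> `|h x| <= C) ->
  mu.-integrable `[a, b] (EFin \o h).
Proof.
move=> mh hC; apply: measurable_bounded_integrable => //.
  exact/compact_finite_measure/segment_compact.
exists C; split; first exact: num_real.
move=> M CM x /=; rewrite in_itv/= => /hC h1; exact: le_trans h1 (ltW CM).
Qed.

Lemma normr_Rintegral_le (a b : R) h (C : R) : a <= b -> measurable_fun `[a, b] h ->
  (forall x, a <= x <= b -> `|h x| <= C) ->
  `|\int[mu]_(x in `[a, b]) h x| <= C * (b - a).
Proof.
move=> ab mh hC; have ih := bounded_integrable mh hC.
apply: (le_trans (le_normr_Rintegral _ ih)) => //.
have -> : C * (b - a) = \int[mu]_(x in `[a, b]) (cst C x).
  by rewrite Rintegral_cst// [X in fine X](measure_segment ab).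
apply: le_Rintegral => //=.
- exact: integrable_norm ih.
- apply: (@bounded_integrable _ _ (cst C) `|C|) => //; exact: measurable_cst.
Qed.

Lemma Rintegral_itv_split (a b c : R) h (C : R) : a <= c -> c <=
  b -> measurable_fun `[a, b] h ->
  (forall x, a <= x <= b -> `|h x| <= C) ->
  \int[mu]_(x in `[a, b]) h x = \int[mu]_(x in `[a, c]) h x + \int[mu]_(x in `[c, b]) h x.
Proof.
move=> ac cb mh hC; have ih := bounded_integrable mh hC.
have := @Rintegral_itvB R h (BLeft a) (BRight b) c ih; rewrite !bnd_simp => /(_ ac cb).
rewrite Rintegral_itv_obnd_cbnd => [<-|]; first by ring.
apply: integrableS ih => //; apply: subset_itv; by rewrite bnd_simp.
Qed.

(** The indefinite integral G of h is Lipschitz and has derivative h almost everywhere, so f - G is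
    covered by [absolutely_continuous_constant]. *)
Theorem absolutely_continuous_FTC (a b : R) f h (C : R) : a < b ->
  absolutely_continuous a b f -> measurable_fun `[a, b] h ->
  (forall x, a <= x <= b -> `|h x| <= C) ->
  {ae mu, forall x, a <= x <= b -> linearized_on `[a, b] f x (h x)} ->
  \int[mu]_(x in `[a, b]) h x = f b - f a.
Proof.
move=> ab fab mh hC fh.
pose h0 := h \_ `[a, b].
(* [h0] vanishes before a. Starting at a - 1 puts every x of [a, b], including a, strictly to the
   right of the lower limit, as [FTC1] requires. *)
pose G y := \int[mu]_(t in [set` Interval (BLeft (a - 1)) (BRight y)]) h0 t.
have ih := bounded_integrable mh hC.
have ih0 : mu.-integrable setT (EFin \o h0).
  rewrite /h0 -restrict_EFin.
  have mab : measurable (`[a, b]%classic : set (measurableTypeR R)) by exact: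
    measurable_itv.
  exact: ((@integrable_mkcond _ (measurableTypeR R) R mu _ (EFin \o h) mab).1 ih).
have GE y : a <= y <= b -> G y = \int[mu]_(t in `[a, y]) h t.
  move=> /andP[ay yb]; rewrite /G -Rintegral_mkcondr; congr Rintegral.
  apply/seteqP; split => t /=; rewrite !in_itv/=.
    by move=> [/andP[_ ->] /andP[->]].
  by move=> /andP[at_ ty]; rewrite at_ ty (le_trans ty yb) (le_trans _ at_)// gerBl.
have GC x y : a <= x -> x <= y -> y <= b -> `|G y - G x| <= C * (y - x).
  move=> ax xy yb.
  rewrite !GE ?ax ?yb ?(le_trans ax) ?(le_trans xy)//.
  have mh' : measurable_fun `[a, y] h.
    by apply: measurable_funS mh => //; apply: subset_itvl; rewrite bnd_simp.
  rewrite (Rintegral_itv_split ax xy mh' (C := C)); last first.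
    by move=> t /andP[at_ ty]; rewrite hC// at_ (le_trans ty).
  rewrite addrC addKr; apply: normr_Rintegral_le => //.
    by apply: measurable_funS mh => //; apply: subset_itv; rewrite bnd_simp.
  by move=> t /andP[xt ty]; rewrite hC// (le_trans ax)// (le_trans ty).
have Gac := lipschitz_absolutely_continuous GC.
have Gh : {ae mu, forall x, a <= x <= b -> linearized_on `[a, b] G x (h x)}.
  have loc := integrable_locally_restrict (measurable_itv `[a, b]) ih.
  have ihy y : mu.-integrable [set` Interval (BLeft (a - 1)) (BRight y)] (EFin \o h0).
    exact: integrableS ih0.
  have := FTC1 ihy loc; apply: (@filterS _ _ (ae_filter_ringOfSetsType mu)) => x /= H xab.
  have [|dG GE'] := H; first by rewrite lte_fin ltrBlDr ltr_pwDr//; case/andP: xab.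
  have <- : h0 x = h x by rewrite /h0 patchE mem_set//= in_itv.
  rewrite -GE' derive1E; exact/is_derive_linearized/derivableP.
have : (f \- G) b = (f \- G) a.
  apply: absolutely_continuous_constant; rewrite ?(ltW ab)//.
    exact: absolutely_continuousB.
  move: fh Gh; apply: (@filterS2 _ _ (ae_filter_ringOfSetsType mu)) => x fx Gx xab.
  by have := linearized_onB (fx xab) (Gx xab); rewrite subrr.
rewrite /= !GE ?lexx ?(ltW ab)// set_itv1 Rintegral_set1 subr0 => <-.
by rewrite opprB addrCA subrr addr0.
Qed.

Lemma absolutely_continuous_measurable a b f : absolutely_continuous a b f ->
  measurable_fun `[a, b] f.
Proof.
move=> /absolutely_continuous_within cf.
exact: subspace_continuous_measurable_fun (measurable_itv _) cf.
Qed.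

Lemma poly_lipschitz a b (p : {poly R}) : exists2 C : R, 0 <= C &
  forall x y, a <= x -> x <= y -> y <= b -> `|p.[y] - p.[x]| <= C * (y - x).
Proof.
have cp : {within `[a, b], continuous (fun x : R => p^`().[x])}.
  by apply: continuous_subspaceT => x; exact: continuous_horner.
have /compact_bounded[M [_ HM]] := continuous_compact cp (@segment_compact R a b).
exists `|M + 1| => // x y ax xy yb.
have [|c] := @MVT_segment R (horner p) (horner p^`()) x y xy (fun z _ =>
  is_derive_poly p z).
  by apply: continuous_subspaceT => z; exact: continuous_horner.
rewrite in_itv/= => /andP[xc cy] ->; rewrite normrM [X in _ * X]ger0_norm ?subr_ge0//.
rewrite ler_wpM2r ?subr_ge0// (le_trans _ (ler_norm _))//.
apply: (HM (M + 1)); first by rewrite ltrDl.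
by exists c => //; rewrite /= in_itv/= (le_trans ax)// (le_trans cy).
Qed.

Lemma poly_bounded a b (p : {poly R}) : exists2 C : R, 0 <= C &
  forall x, a <= x <= b -> `|p.[x]| <= C.
Proof.
have cp : {within `[a, b], continuous (fun x : R => p.[x])}.
  by apply: continuous_subspaceT => x; exact: continuous_horner.
have /compact_bounded[M [_ HM]] := continuous_compact cp (@segment_compact R a b).
exists `|M + 1| => // x xab; rewrite (le_trans _ (ler_norm _))//.
by apply: (HM (M + 1)); [rewrite ltrDl | exists x].
Qed.

Lemma measurable_horner (D : set R) (p : {poly R}) :
  measurable_fun D (fun x : R => p.[x]).
Proof.
apply: (measurable_funS _ (@subsetT _ D)) => //.
by apply: continuous_measurable_fun; exact: continuous_horner.
Qed.

Lemma absolutely_continuous_by_parts a b f h (C : R) (p : {poly R}) : a < b ->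
  absolutely_continuous a b f -> measurable_fun `[a, b] h ->
  (forall x, a <= x <= b -> `|h x| <= C) ->
  {ae mu, forall x, a <= x <= b -> linearized_on `[a, b] f x (h x)} ->
  \int[mu]_(x in `[a, b]) (f x * p^`().[x]) =
    f b * p.[b] - f a * p.[a] - \int[mu]_(x in `[a, b]) (h x * p.[x]).
Proof.
move=> ab fab mh hC fh.
have [L L0 pL] := poly_lipschitz a b p.
have [B B0 pB] := poly_bounded a b p.
have [B' B'0 pB'] := poly_bounded a b p^`().
have [A fA] := absolutely_continuous_bounded fab.
have mf := absolutely_continuous_measurable fab.
have mfp : measurable_fun `[a, b] (fun x => f x * p^`().[x]).
  by apply: measurable_funM => //; exact: measurable_horner.
have mhp : measurable_fun `[a, b] (fun x => h x * p.[x]).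
  by apply: measurable_funM => //; exact: measurable_horner.
have bfp x : a <= x <= b -> `|f x * p^`().[x]| <= A * B'.
  by move=> xab; rewrite normrM ler_pM// ?fA ?pB'.
have bhp x : a <= x <= b -> `|h x * p.[x]| <= C * B.
  by move=> xab; rewrite normrM ler_pM// ?hC ?pB.
rewrite -(@absolutely_continuous_FTC a b (f \* horner p)
   (fun x => h x * p.[x] + f x * p^`().[x]) (C * B + A * B') ab); last 4 first.
- exact: absolutely_continuousM pL.
- exact: measurable_funD.
- by move=> x xab; rewrite (le_trans (ler_normD _ _))// lerD ?bfp ?bhp.
- move: fh; apply: (@filterS _ _ (ae_filter_ringOfSetsType mu)) => x fx xab;
  apply: linearized_onM; first exact: fx.
  by apply: is_derive_linearized; exact: is_derive_poly.
rewrite RintegralD//; first by rewrite [X in X - _]addrC addrK.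
- exact: bounded_integrable bhp.
- exact: bounded_integrable bfp.
Qed.


End absolute_continuity.

(** * Functions of bounded variation *)

Section bounded_variation_integral.
Variable R : realType.
Local Notation mu := (@lebesgue_measure R).
Implicit Types (a b : R) (g : R -> R).

Lemma bounded_variation_measurable a b g : bounded_variation a b g ->
  measurable_fun `[a, b] g.
Proof.
move=> gab.
(* Applied to both parts of the Jordan decomposition of g. Clamping the argument into [a, b] extends
   h to a nondecreasing function on the whole line. *)
have clamp (h : R -> R) : {in `[a, b] &, nondecreasing_fun h} -> measurable_fun `[a, b] h.
  move=> hnd.
  have [ab|ba] := leP a b; last by rewrite set_itv_ge ?bnd_simp -?ltNge//;
    exact: measurable_fun_set0.
  have E : {in `[a, b]%classic, (fun x => h (Order.max a (Order.min x b))) =1 h}.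
    move=> x; rewrite inE/= in_itv/= => /andP[ax xb].
    by rewrite (min_idPl xb) (max_idPr ax).
  refine (eq_measurable_fun _ E _).
  apply: nondecreasing_measurable => // x y xy; apply: hnd.
  - by rewrite in_itv/= le_max lexx/= ge_max ab ge_min lexx orbT.
  - by rewrite in_itv/= le_max lexx/= ge_max ab ge_min lexx orbT.
  - by rewrite le_max2 ?lexx// le_min2 ?lexx.
have E : {in `[a, b]%classic, (fine \o pos_tv a g) \- (fine \o neg_tv a g) =1 g}.
  by move=> x; rewrite inE => xab; rewrite [RHS](bounded_variation_pos_neg_tvE gab).
refine (eq_measurable_fun _ E _).
apply: measurable_funB; apply: clamp; last exact: fine_neg_tv_nondecreasing.
exact/fine_neg_tv_nondecreasing/bounded_variationN.
Qed.

Definition variation_function a g (x : R) : R := fine (total_variation a x g).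

Lemma variation_function_dist a b g x y : bounded_variation a b g ->
  a <= x -> x <= y -> y <= b ->
  `|g y - g x| <= variation_function a g y - variation_function a g x.
Proof.
move=> gab ax xy yb.
have ay := le_trans ax xy; have ab := le_trans ay yb.
have gay := bounded_variationl ay yb gab.
have gax := bounded_variationl ax xy gay.
have gxy := bounded_variationr ax xy gay.
have fx := (bounded_variationP g ax).1 gax.
have fxy := (bounded_variationP g xy).1 gxy.
rewrite /variation_function (total_variationD g ax xy) fineD// addrAC subrr add0r.
by rewrite -lee_fin fineK//; exact: total_variation_ge.
Qed.

Lemma bounded_variation_bounded a b g : bounded_variation a b g ->
  exists C : R, forall x, a <= x <= b -> `|g x| <= C.
Proof.
move=> gab; exists (`|g a| + variation_function a g b) => x /andP[ax xb].
have h1 := variation_function_dist gab (lexx a) ax xb.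
have h2 := variation_function_dist gab ax xb (lexx b).
have h0 : variation_function a g a = 0 by rewrite /variation_function total_variationxx.
have -> : g x = g a + (g x - g a) by rewrite addrC subrK.
apply: (le_trans (ler_normD _ _)); rewrite lerD2l.
by have := normr_ge0 (g b - g x); lra.
Qed.

Lemma Rintegral_deriv_poly a b (p : {poly R}) : a <= b ->
  \int[mu]_(x in `[a, b]) p^`().[x] = p.[b] - p.[a].
Proof.
rewrite le_eqVlt => /predU1P[<-|ab].
  by rewrite set_itv1 Rintegral_set1 subrr.
have [L L0 pL] := poly_lipschitz a b p.
have [B B0 pB] := poly_bounded a b p^`().
apply: (absolutely_continuous_FTC ab (C := B)) => //.
- exact: lipschitz_absolutely_continuous pL.
- exact: measurable_horner.
- apply: (@aeW _ _ _ mu) => x _.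
  by apply: is_derive_linearized; exact: is_derive_poly.
Qed.

(* Integration by parts on a short interval, with g frozen at the left endpoint. *)
Lemma bounded_variation_integral_step a b g (q : {poly R}) (M B c d : R) :
  bounded_variation a b g ->
  (forall x, a <= x <= b -> `|q.[x]| <= M) ->
  (forall x, a <= x <= b -> `|q^`().[x]| <= B) ->
  a <= c -> c <= d -> d <= b ->
  `|\int[mu]_(x in `[c, d]) (g x * q^`().[x]) - (g d * q.[d] - g c * q.[c])| <=
  (M + B * (d - c)) * (variation_function a g d - variation_function a g c).
Proof.
move=> gab qM qB ac cd db.
set W := _ - variation_function a g c.
have W0 : 0 <= W by apply: le_trans (variation_function_dist gab ac cd db).
have mg : measurable_fun `[c, d] g.
  apply: measurable_funS (bounded_variation_measurable gab) => //.
  by apply: subset_itv; rewrite bnd_simp.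
have inab x : c <= x <= d -> a <= x <= b.
  by move=> /andP[cx xd]; rewrite (le_trans ac)// (le_trans xd).
have B0 : 0 <= B by rewrite (le_trans _ (qB c _))// ac (le_trans cd).
have mq : measurable_fun `[c, d] (fun x => q^`().[x]) by exact: measurable_horner.
have mgc : measurable_fun `[c, d] (fun x => (g x - g c) * q^`().[x]).
  by apply: measurable_funM => //; apply: measurable_funB.
have bgc x : c <= x <= d -> `|(g x - g c) * q^`().[x]| <= W * B.
  move=> xcd; have /andP[cx xd] := xcd.
  rewrite normrM ler_pM// ?qB ?inab// (le_trans (variation_function_dist gab ac cx _))//.
    by rewrite (le_trans xd).
  rewrite lerD2r -subr_ge0; apply: le_trans (variation_function_dist gab _ xd db) => //.
  by rewrite (le_trans ac).
have -> : \int[mu]_(x in `[c, d]) (g x * q^`().[x]) =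
  \int[mu]_(x in `[c, d]) ((g x - g c) * q^`().[x]) + g c * (q.[d] - q.[c]).
  rewrite -Rintegral_deriv_poly// -RintegralZl//; last first.
    by apply: (bounded_integrable (C := B)) => // x /inab; exact: qB.
  rewrite -RintegralD//; last 2 first.
  - exact: bounded_integrable bgc.
  - apply: (bounded_integrable (C := `|g c| * B)).
      by apply: measurable_funM.
    by move=> x /inab xab; rewrite normrM ler_wpM2l// qB.
  by apply: eq_Rintegral => x _; ring.
set I := \int[mu]_(x in _) _.
have -> : I + g c * (q.[d] - q.[c]) - (g d * q.[d] - g c * q.[c]) =
  I - (g d - g c) * q.[d] by ring.
apply: (le_trans (ler_normB _ _)).
have I1 : `|I| <= W * B * (d - c) by apply: normr_Rintegral_le.
have I2 : `|(g d - g c) * q.[d]| <= W * M.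
  rewrite normrM ler_pM// ?(variation_function_dist gab)// qM//.
  by rewrite (le_trans ac).
by apply: (le_trans (lerD I1 I2)); rewrite le_eqVlt; apply/orP; left; apply/eqP; ring.
Qed.

(** The estimate |int q dg| <= M V, without the Stieltjes integral: over a uniform partition the
    boundary terms of [bounded_variation_integral_step] telescope to g q, which vanishes at a and b,
    and the excess B times the mesh times V tends to 0. *)
Theorem bounded_variation_integral_le a b g (q : {poly R}) (M : R) : a <= b ->
  bounded_variation a b g -> q.[a] = 0 -> q.[b] = 0 ->
  (forall x, a <= x <= b -> `|q.[x]| <= M) ->
  `|\int[mu]_(x in `[a, b]) (g x * q^`().[x])| <= M * fine (total_variation a b g).
Proof.
move=> ab gab qa qb qM.
have [B B0 qB] := poly_bounded a b q^`().
have [C gC] := bounded_variation_bounded gab.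
have mgq : measurable_fun `[a, b] (fun x => g x * q^`().[x]).
  apply: measurable_funM; first exact: bounded_variation_measurable.
  exact: measurable_horner.
have bgq x : a <= x <= b -> `|g x * q^`().[x]| <= C * B.
  by move=> xab; rewrite normrM ler_pM ?gC ?qB.
set V := variation_function a g.
have Va : V a = 0 by rewrite /V /variation_function total_variationxx.
rewrite -/(V b).
have Vb : 0 <= V b.
  by have := variation_function_dist gab (lexx a) ab (lexx b); rewrite -/V Va subr0;
    exact: le_trans.
have main n : `|\int[mu]_(x in `[a, b]) (g x * q^`().[x])| <=
    (M + B * ((b - a) / n.+1%:R)) * V b.
  pose h := (b - a) / n.+1%:R.
  have h0 : 0 <= h by rewrite divr_ge0// subr_ge0.
  pose x j := a + h * j%:R.
  have xn : x n.+1 = b by rewrite /x /h divfK ?pnatr_eq0// addrC subrK.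
  have x0 : x 0%N = a by rewrite /x mulr0 addr0.
  have xS j : x j <= x j.+1 by rewrite /x lerD2l ler_wpM2l// ler_nat.
  have ax j : a <= x j by rewrite /x lerDl mulr_ge0.
  have xb j : (j <= n.+1)%N -> x j <= b.
    by move=> jn; rewrite -xn /x lerD2l ler_wpM2l// ler_nat.
  have : forall j, (j <= n.+1)%N ->
      `|\int[mu]_(t in `[a, x j]) (g t * q^`().[t]) - g (x j) * q.[x j]| <=
        (M + B * h) * V (x j).
    elim=> [_|j IH jn].
      by rewrite x0 set_itv1 Rintegral_set1 qa mulr0 subr0 normr0 Va mulr0.
    have {}IH := IH (ltnW jn).
    have := bounded_variation_integral_step gab qM qB (ax j) (xS j) (xb _ jn).
    have -> : x j.+1 - x j = h by rewrite /x -natr1; ring.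
    rewrite -/V => st.
    rewrite (@Rintegral_itv_split R a (x j.+1) (x j) _ (C * B) (ax j) (xS j));
      last 2 first.
    - apply: measurable_funS mgq => //; apply: subset_itvl; rewrite bnd_simp; exact: xb.
    - by move=> t /andP[at_ tx]; apply: bgq; rewrite at_ (le_trans tx)// xb.
    move: st IH; set I1 := Rintegral _ _ _; set I2 := Rintegral _ _ _ => st IH.
    rewrite [X in `|X|](_ : _ = (I2 - g (x j) * q.[x j]) +
       (I1 - (g (x j.+1) * q.[x j.+1] - g (x j) * q.[x j]))); last by ring.
    by apply: (le_trans (ler_normD _ _)); apply: (le_trans (lerD IH st));
      rewrite -mulrDr [X in _ * X]addrC subrK.
  by move=> /(_ n.+1 (leqnn _)); rewrite xn qb mulr0 subr0.
apply/ler_addgt0Pr => e e0.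
pose N := Num.bound (B * (b - a) * V b / e).
have hN : B * (b - a) * V b / e < N.+1%:R.
  have NP : B * (b - a) * V b / e < N%:R.
    by apply: archi_boundP; rewrite divr_ge0 ?(ltW e0)// !mulr_ge0// subr_ge0.
  by apply: (lt_trans NP); rewrite ltr_nat.
apply: (le_trans (main N)); rewrite mulrDl lerD2l.
have -> : B * ((b - a) / N.+1%:R) * V b = B * (b - a) * V b / N.+1%:R by ring.
by move: hN; rewrite ltr_pdivrMr// => /ltW hN; rewrite ler_pdivrMr ?ltr0n// [leRHS]mulrC.
Qed.


End bounded_variation_integral.

(** * Legendre coefficients *)

Section legendre_coefficients.
Variable R : realType.
Local Notation mu := (@lebesgue_measure R).
Implicit Types f g h : R -> R.

(** At k = 0 the radicand is negative and the root is 0, so monotonicity starts at k = 1. *)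
Definition legendre_bound (k : nat) : R := Num.sqrt (2 / pi / (k%:R - 2^-1)).

Lemma legendre_bound_ge0 k : 0 <= legendre_bound k.
Proof. exact: sqrtr_ge0. Qed.

Lemma legendre_bound_le k l : (0 < k)%N -> (k <= l)%N ->
  legendre_bound l <= legendre_bound k.
Proof.
move=> k0 kl; rewrite /legendre_bound ler_wsqrtr//.
have k1 : 1 <= k%:R :> R by rewrite ler1n.
have kl' : k%:R <= l%:R :> R by rewrite ler_nat.
rewrite ler_wpM2l ?divr_ge0 ?pi_ge0// lef_pV2 ?posrE; lra.
Qed.

Lemma bounded_integrableM f (C : R) (p : {poly R}) :
  measurable_fun `[-1 : R, 1] f -> (forall x, -1 <= x <= 1 -> `|f x| <= C) ->
  mu.-integrable `[-1, 1] (EFin \o (fun x => f x * p.[x])).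
Proof.
move=> mf fC; have [B B0 pB] := poly_bounded (-1) 1 p.
apply: (bounded_integrable (C := C * B)).
  by apply: measurable_funM => //; exact: measurable_horner.
by move=> x x1; rewrite normrM ler_pM ?fC ?pB.
Qed.

(** The derivative of the kernel is (2k + 3) P_(k+1), and the normalization k + 3/2 is half of that
    factor. *)
Lemma legendre_coefE f (C : R) k :
  measurable_fun `[-1 : R, 1] f -> (forall x, -1 <= x <= 1 -> `|f x| <= C) ->
  legendre_coef f k.+1 = 2^-1 *
  \int[mu]_(x in `[-1, 1]) (f x * (legendre R k.+2 - legendre R k)^`().[x]).
Proof.
move=> mf fC; rewrite /legendre_coef /Omega deriv_legendre_kernel.
have -> : \int[mu]_(x in `[-1, 1]) (f x * (legendre R k.+1 *+ (2 * k.+1 + 1)).[x]) =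
  \int[mu]_(x in `[-1, 1]) ((2 * k.+1 + 1)%:R * (f x * (legendre R k.+1).[x])).
  by apply: eq_Rintegral => x _; rewrite hornerMn mulrnAr mulr_natl.
rewrite RintegralZl//; last exact: bounded_integrableM fC.
by rewrite mulrA natrD natrM; congr (_ * _); field.
Qed.

Lemma legendre_kernel_at1 k : (legendre R k.+2 - legendre R k).[1] = 0.
Proof. by rewrite hornerD hornerN !legendre_at1 subrr. Qed.

Lemma legendre_kernel_atN1 k : (legendre R k.+2 - legendre R k).[-1] = 0.
Proof. by rewrite hornerD hornerN !legendre_atN1 !exprS mulrA mulrNN !mul1r subrr. Qed.

Lemma legendre_coef_variation g k : bounded_variation (-1) 1 g ->
  `|legendre_coef g k.+1| <= legendre_bound k.+1 * fine (total_variation (-1) 1 g).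
Proof.
move=> gBV; have [C gC] := bounded_variation_bounded gBV.
rewrite (legendre_coefE _ (bounded_variation_measurable gBV) gC) normrM ger0_norm//.
have N11 : -1 <= 1 :> R by lra.
have := bounded_variation_integral_le N11 gBV (legendre_kernel_atN1 k)
  (legendre_kernel_at1 k) (M := 2 * legendre_bound k.+1).
move=> h; rewrite mulrC ler_pdivrMr// mulrC mulrA; apply: h => x x1.
have h := legendre_kernel_le R k x x1.
have pi0 := @pi_gt0 R.
have k1 : 1 <= k.+1%:R :> R by rewrite ler1n.
have := ler_wsqrtr h; rewrite sqrtr_sqr normrM normfV -/(legendre_bound k.+1).
by rewrite hornerD hornerN [`|2|]ger0_norm// ler_pdivrMr// mulrC.
Qed.

Lemma legendre_coef_deriv f h (C : R) k :
  absolutely_continuous (-1) 1 f -> measurable_fun `[-1 : R, 1] h ->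
  (forall x, -1 <= x <= 1 -> `|h x| <= C) ->
  {ae mu, forall x, -1 <= x <= 1 -> linearized_on `[-1, 1] f x (h x)} ->
  legendre_coef f k.+1 =
    legendre_coef h k / (2 * k%:R + 1) - legendre_coef h k.+2 / (2 * k%:R + 5).
Proof.
move=> fac mh hC fh; have [A fA] := absolutely_continuous_bounded fac.
rewrite (legendre_coefE _ (absolutely_continuous_measurable fac) fA).
rewrite (absolutely_continuous_by_parts _ _ fac mh hC fh); last lra.
rewrite legendre_kernel_at1 legendre_kernel_atN1 !mulr0 subrr sub0r.
have -> : \int[mu]_(x in `[-1, 1]) (h x * (legendre R k.+2 - legendre R k).[x]) =
  \int[mu]_(x in `[-1, 1]) (h x * (legendre R k.+2).[x]) -
  \int[mu]_(x in `[-1, 1]) (h x * (legendre R k).[x]).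
  rewrite -RintegralB//; try exact: bounded_integrableM hC.
  apply: eq_Rintegral => x _.
  by rewrite hornerD hornerN mulrBr.
rewrite /legendre_coef /Omega -!natr1.
have k0 : 0 <= k%:R :> R by [].
by field; apply/andP; split; lra.
Qed.

(** Stated for a sequence of successive almost everywhere derivatives, so that the last member may
    be the chosen function of bounded variation instead of an actual derivative. The induction
    removes the first member. *)
Lemma legendre_coef_le m (F : nat -> R -> R) k :
  (forall i, (i < m)%N -> absolutely_continuous (-1) 1 (F i)) ->
  (forall i, (i < m)%N ->
    {ae mu, forall x, -1 <= x <= 1 -> linearized_on `[-1, 1] (F i) x (F i.+1 x)}) ->
  bounded_variation (-1) 1 (F m) -> (m < k)%N ->
  `|legendre_coef (F 0%N) k| <= fine (total_variation (-1) 1 (F m)) *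
    legendre_bound (k - m) * \prod_(1 <= l < m.+1) (k%:R - l%:R + 2^-1)^-1.
Proof.
elim: m F k => [|m IH] F k Fac Fd FBV.
  by case: k => // k _; rewrite big_geq// mulr1 subn0 mulrC;
    exact: legendre_coef_variation.
case: k => [//|k] mk.
set V := fine _.
have V0 : 0 <= V by rewrite fine_ge0// total_variation_ge0//; lra.
(* [F 1] is the function of bounded variation if it is the last member, and absolutely continuous
   otherwise. *)
have F1m : measurable_fun `[-1 : R, 1] (F 1%N).
  case: m {IH} Fac Fd FBV mk @V V0 => [|m] Fac Fd FBV mk V V0.
    exact: bounded_variation_measurable.
  by apply: absolutely_continuous_measurable; exact: Fac.
have [C F1C] : exists C : R, forall x, -1 <= x <= 1 -> `|F 1%N x| <= C.
  case: m {IH} Fac Fd FBV mk @V V0 => [|m] Fac Fd FBV mk V V0.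
    exact: bounded_variation_bounded.
  by apply: absolutely_continuous_bounded; exact: Fac.
rewrite (legendre_coef_deriv k (Fac 0%N isT) F1m F1C (Fd 0%N isT)).
have {}IH l : (m < l)%N -> `|legendre_coef (F 1%N) l| <= V * legendre_bound (l - m) *
    \prod_(1 <= i < m.+1) (l%:R - i%:R + 2^-1)^-1.
  apply: (IH (fun i => F i.+1)) => // i im; [exact: Fac|exact: Fd].
have km : (m < k)%N by [].
have k0 : 0 <= k%:R :> R by [].
have k2 : k.+2%:R = k%:R + 2 :> R by rewrite -addn2 natrD.
have mono : V * legendre_bound (k.+2 - m) * \prod_(1 <=
  i < m.+1) (k.+2%:R - i%:R + 2^-1)^-1 <=
   V * legendre_bound (k - m) * \prod_(1 <= i < m.+1) (k%:R - i%:R + 2^-1)^-1.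
  apply: ler_pM.
  - by rewrite mulr_ge0// legendre_bound_ge0.
  - rewrite big_nat_cond; apply: prodr_ge0 => i /andP[/andP[i1 im] _].
    have ik : i%:R <= k%:R :> R by rewrite ler_nat; lia.
    by rewrite invr_ge0 k2; lra.
  - by rewrite ler_wpM2l// legendre_bound_le//; lia.
  - rewrite big_nat_cond [leRHS]big_nat_cond; apply: ler_prod => i /andP[/andP[i1 im] _].
    have ik : i%:R <= k%:R :> R by rewrite ler_nat; lia.
    by rewrite invr_ge0 k2 lef_pV2 ?posrE; lra.
set D := (X in _ <= X) in mono.
have D0 : 0 <= D by apply: le_trans (IH k km); exact: normr_ge0.
(* By [mono] both coefficients are at most D. With 1 / (2k + 5) enlarged to 1 / (2k + 1), the two
   terms add up to D / (k + 1/2), whose denominator is the factor l = 1 at index k + 1. *)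
apply: (@le_trans _ _ (D / (k%:R + 2^-1))).
  apply: (le_trans (ler_normB _ _)).
  rewrite (normrM (legendre_coef _ k)) (normrM (legendre_coef _ k.+2)) !normfV.
  rewrite [`|2 * k%:R + 1|]ger0_norm ?[`|2 * k%:R + 5|]ger0_norm; [|lra..].
  have h1 : `|legendre_coef (F 1%N) k| / (2 * k%:R + 1) <= D / (2 * k%:R + 1).
    by rewrite ler_wpM2r ?invr_ge0 ?IH//; lra.
  have h2 : `|legendre_coef (F 1%N) k.+2| / (2 * k%:R + 5) <= D / (2 * k%:R + 1).
    apply: ler_pM => //.
      by apply: (le_trans _ mono); apply: IH; lia.
    by rewrite lef_pV2 ?posrE; lra.
  apply: (le_trans (lerD h1 h2)).
  by rewrite le_eqVlt; apply/orP; left; apply/eqP; field; lra.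
rewrite subSS big_nat_recl// /D -!mulrA !ler_wpM2l ?legendre_bound_ge0//.
rewrite mulrC le_eqVlt; apply/orP; left; apply/eqP; congr (_ * _).
  by rewrite -natr1; congr (_^-1); ring.
by apply: eq_big_nat => i _; congr (_^-1); rewrite -!natr1; ring.
Qed.
End legendre_coefficients.

(** * Bessel's inequality and the Christoffel-Darboux formula *)

Section orthogonality.
Variable R : realType.
Local Notation mu := (@lebesgue_measure R).
Local Notation P := (legendre R).
Implicit Types (p q : {poly R}) (h : R -> R).

Lemma measurable_invr : measurable_fun [set: R] (fun y : R => y^-1).
Proof.
have -> : [set: R] = [set y | y != 0] `|` [set 0].
  apply/seteqP; split => // y _; have [->|y0] := eqVneq y 0; [by right|by left].
have o0 : open [set y : R | y != 0] by exact: open_neq.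
apply/measurable_funU => //; first exact: open_measurable.
split; last exact: measurable_fun_set1.
apply: open_continuous_measurable_fun => // y; rewrite inE/= => y0.
exact: inv_continuous.
Qed.

Definition moment h p : R := \int[mu]_(x in `[-1, 1]) (h x * p.[x]).

Definition polyint p : R := \int[mu]_(x in `[-1, 1]) p.[x].

Lemma integrable_horner p : mu.-integrable `[-1, 1] (EFin \o (fun x => p.[x])).
Proof.
have [B B0 pB] := poly_bounded (-1) 1 p.
by apply: bounded_integrable pB; exact: measurable_horner.
Qed.

Lemma polyint_deriv p : polyint p^`() = p.[1] - p.[-1].
Proof. by apply: Rintegral_deriv_poly; lra. Qed.

Lemma polyintE p : polyint p = moment (cst 1) p.
Proof. by apply: eq_Rintegral => x _; rewrite mul1r. Qed.

Section moment.
Variables (h : R -> R) (C : R).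
Hypotheses (mh : measurable_fun `[-1 : R, 1] h)
  (hC : forall x, -1 <= x <= 1 -> `|h x| <= C).

Let ih p := bounded_integrableM p mh hC.

Lemma momentD p q : moment h (p + q) = moment h p + moment h q.
Proof.
rewrite /moment -RintegralD//; [|exact: ih..].
by apply: eq_Rintegral => x _; rewrite hornerD mulrDr.
Qed.

Lemma momentZ c p : moment h (c *: p) = c * moment h p.
Proof.
have hp := ih p; rewrite /moment.
under eq_Rintegral do rewrite hornerZ mulrCA.
by rewrite RintegralZl.
Qed.

Lemma momentN p : moment h (- p) = - moment h p.
Proof. by rewrite -scaleN1r momentZ mulN1r. Qed.

Lemma momentB p q : moment h (p - q) = moment h p - moment h q.
Proof. by rewrite momentD momentN. Qed.

Lemma momentMn p n : moment h (p *+ n) = n%:R * moment h p.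
Proof. by rewrite -scaler_nat momentZ. Qed.

Lemma moment_sum n (F : nat -> {poly R}) :
  moment h (\sum_(0 <= i < n) F i) = \sum_(0 <= i < n) moment h (F i).
Proof.
elim: n => [|n IH]; last by rewrite !big_nat_recr//= momentD IH.
by rewrite !big_geq// -(scale0r 0) momentZ mul0r.
Qed.

End moment.

Lemma measurable_one : measurable_fun `[-1 : R, 1] (cst 1 : R -> R).
Proof. exact: measurable_cst. Qed.

Lemma one_bounded (x : R) : -1 <= x <= 1 -> `|cst 1 x| <= 1 :> R.
Proof. by rewrite normr1. Qed.

Lemma polyintZ c p : polyint (c *: p) = c * polyint p.
Proof. by rewrite !polyintE (momentZ measurable_one one_bounded). Qed.

Lemma polyintB p q : polyint (p - q) = polyint p - polyint q.
Proof. by rewrite !polyintE (momentB measurable_one one_bounded). Qed.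

Lemma polyintMn p n : polyint (p *+ n) = n%:R * polyint p.
Proof. by rewrite !polyintE (momentMn measurable_one one_bounded). Qed.

Lemma polyint_sum n (F : nat -> {poly R}) :
  polyint (\sum_(0 <= i < n) F i) = \sum_(0 <= i < n) polyint (F i).
Proof.
rewrite polyintE (moment_sum measurable_one one_bounded).
by apply: eq_bigr => i _; rewrite polyintE.
Qed.

Lemma polyint_legendre0 : polyint (P 0) = 2.
Proof.
have <- : ('X)^`() = P 0 by rewrite derivX legendre0.
by rewrite polyint_deriv !hornerX opprK.
Qed.

Lemma polyint_legendreS k : polyint (P k.+1) = 0.
Proof.
have : polyint (P k.+2 - P k)^`() = 0.
  by rewrite polyint_deriv legendre_kernel_at1 legendre_kernel_atN1 subrr.
rewrite deriv_legendre_kernel polyintMn => /eqP.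
by rewrite mulf_eq0 pnatr_eq0 addn1 => /eqP.
Qed.

(** The weighted Wronskian W vanishes at both endpoints, and by the differential equation its
    derivative is (k (k + 1) - j (j + 1)) P_j P_k. *)
Lemma legendre_orthogonal (j k : nat) : j != k -> polyint (P j * P k) = 0.
Proof.
move=> jk.
pose W := (1 - 'X ^+ 2) * ((P j)^`() * P k - (P k)^`() * P j).
have : polyint W^`() = 0.
  by rewrite polyint_deriv /W !hornerM !hornerD !hornerN !hornerXn !hornerC sqrrN
    expr1n subrr !mul0r subr0.
have -> : W^`() = (P j * P k) *+ (k * k.+1) - (P j * P k) *+ (j * j.+1).
  have -> : W = ((1 - 'X ^+ 2) * (P j)^`()) * P k - ((1 - 'X ^+ 2) * (P k)^`()) * P j.
    by rewrite /W; ring.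
  rewrite derivB !(derivM (_ * _)) !legendre_ode; ring.
rewrite polyintB !polyintMn -mulrBl => /eqP;
  rewrite mulf_eq0 subr_eq0 eqr_nat => /orP[/eqP e|/eqP //].
by case: ltngtP jk => // jk _; have := ltn_mul jk (jk : (_.+1 < _.+1)%N); rewrite e ltnn.
Qed.

(** Bonnet's recurrence in two consecutive degrees evaluates the integral of x P_(j+1) P_(j+2) in
    two ways, which relates consecutive norms. *)
Lemma legendre_norm k : polyint (P k * P k) = 2 / (2 * k%:R + 1).
Proof.
have rec j : (2 * j%:R + 5) * polyint (P j.+2 * P j.+2) =
  (2 * j%:R + 3) * polyint (P j.+1 * P j.+1).
  have h1 : polyint (P j.+2 * (P j.+2 *+ j.+2)) =
      polyint (P j.+2 * (('X * P j.+1) *+ (2 * j.+1 + 1) - P j *+ j.+1)).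
    by rewrite legendre_bonnet.
  have h2 : polyint (P j.+1 * (P j.+3 *+ j.+3)) =
      polyint (P j.+1 * (('X * P j.+2) *+ (2 * j.+2 + 1) - P j.+1 *+ j.+2)).
    by rewrite legendre_bonnet.
  have XP : P j.+1 * ('X * P j.+2) = P j.+2 * ('X * P j.+1) by ring.
  have o1 : polyint (P j.+2 * P j) = 0 by apply: legendre_orthogonal;
    rewrite eqn_leq; lia.
  have o2 : polyint (P j.+1 * P j.+3) = 0 by apply: legendre_orthogonal;
    rewrite eqn_leq; lia.
  rewrite mulrBr !mulrnAr polyintB !polyintMn o1 mulr0 subr0 in h1.
  rewrite mulrBr !mulrnAr polyintB !polyintMn o2 mulr0 XP in h2.
  move/esym/eqP: h2; rewrite subr_eq0 => /eqP h2.
  set I := polyint (P j.+2 * P j.+2) in h1 *; set J := polyint (P j.+2 * _) in h1 h2.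
  set K := polyint (P j.+1 * P j.+1) in h2 *.
  have j0 : 0 <= j%:R :> R by [].
  have e1 : j.+2%:R = j%:R + 2 :> R by rewrite -addn2 natrD.
  have e2 : (2 * j.+1 + 1)%:R = 2 * j%:R + 3 :> R.
    by rewrite -natrM -natrD; congr (_%:R); lia.
  have e3 : (2 * j.+2 + 1)%:R = 2 * j%:R + 5 :> R.
    by rewrite -natrM -natrD; congr (_%:R); lia.
  rewrite e1 e2 in h1; rewrite e1 e3 in h2.
  apply: (@mulfI _ (j%:R + 2)); first by rewrite gt_eqF//; lra.
  have -> : (j%:R + 2) * ((2 * j%:R + 5) * I) = (2 * j%:R + 5) * ((j%:R + 2) * I) by ring.
  rewrite h1.
  have -> : (2 * j%:R + 5) * ((2 * j%:R + 3) * J) =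
    (2 * j%:R + 3) * ((2 * j%:R + 5) * J) by ring.
  by rewrite h2; ring.
case: k => [|k].
  by rewrite legendre0 mul1r -legendre0 polyint_legendre0 mulr0 add0r divr1.
elim: k => [|k IH].
  have -> : P 1 * P 1 = (3^-1 *: ('X ^+ 3))^`().
    by rewrite legendre1 derivZ derivXn /= -[X in _ *: X]scaler_nat scalerA mulVf
      ?scale1r.
  by rewrite polyint_deriv !hornerZ !hornerXn expr1n; field.
have k0 : 0 <= k%:R :> R by [].
have e1 : 2 * k.+1%:R + 1 = 2 * k%:R + 3 :> R by rewrite -natr1; ring.
have e2 : 2 * k.+2%:R + 1 = 2 * k%:R + 5 :> R by rewrite -addn2 natrD; ring.
have := rec k; rewrite IH e1 e2 => h.
apply: (@mulfI _ (2 * k%:R + 5)); first by rewrite gt_eqF//; lra.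
by rewrite h; field; apply/andP; split; lra.
Qed.

(** The integral of (h - S)^2 is nonnegative, and both the moment of h against S and the integral of
    S^2 equal the sum; the factor 2 is the length of [-1, 1]. *)
Lemma bessel h (C : R) N : measurable_fun `[-1 : R, 1] h ->
  (forall x, -1 <= x <= 1 -> `|h x| <= C) ->
  \sum_(0 <= k < N) (k%:R + 2^-1) * moment h (P k) ^+ 2 <= 2 * C ^+ 2.
Proof.
move=> mh hC.
pose c k := (k%:R + 2^-1) * moment h (P k).
pose S : {poly R} := \sum_(0 <= k < N) c k *: P k.
pose B := \sum_(0 <= k < N) (k%:R + 2^-1) * moment h (P k) ^+ 2.
have hS : moment h S = B.
  rewrite (moment_sum mh hC); apply: eq_bigr => k _.
  by rewrite (momentZ mh hC) /c expr2 mulrA.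
have SP k : (k < N)%N -> polyint (S * P k) = moment h (P k).
  move=> kN; rewrite /S big_distrl polyint_sum /=.
  rewrite (bigD1_seq k) ?mem_index_iota ?iota_uniq//= big1_seq.
    rewrite -scalerAl polyintZ legendre_norm addr0 /c mulrAC -[RHS]mul1r; congr (_ * _).
    by field; have : 0 <= k%:R :> R by []; lra.
  by move=> i /andP[ik _]; rewrite -scalerAl polyintZ legendre_orthogonal ?mulr0.
have SS : polyint (S * S) = B.
  rewrite {2}/S big_distrr polyint_sum /= /B !big_nat; apply: eq_bigr => k /andP[_ kN].
  by rewrite -scalerAr polyintZ SP// /c expr2 mulrA.
have C0 : 0 <= C by apply: le_trans (hC 0 _); rewrite ?normr_ge0//; lra.
have ih2 : mu.-integrable `[-1, 1] (EFin \o (fun x => h x ^+ 2)).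
  apply: (bounded_integrable (C := C ^+ 2)); first exact: measurable_funX.
  by move=> x x1; rewrite normrX lerXn2r ?nnegrE// hC.
have : 0 <= \int[mu]_(x in `[-1, 1]) (h x - S.[x]) ^+ 2.
  by apply: Rintegral_ge0 => x _; exact: sqr_ge0.
have -> : \int[mu]_(x in `[-1, 1]) (h x - S.[x]) ^+ 2 =
  \int[mu]_(x in `[-1, 1]) (h x ^+ 2) - 2 * moment h S + polyint (S * S).
  rewrite -(momentZ mh hC) /moment -RintegralB//; last exact: bounded_integrableM hC.
  rewrite /polyint -RintegralD//; last exact: integrable_horner.
    by apply: eq_Rintegral => x _; rewrite hornerZ hornerM; ring.
  have [A A0 SA] := poly_bounded (-1) 1 (2 *: S).
  apply: (bounded_integrable (C := C ^+ 2 + C * A)).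
    by apply: measurable_funB; [exact: measurable_funX|apply: measurable_funM => //;
      exact: measurable_horner].
  move=> x x1; apply: (le_trans (ler_normB _ _)).
  by rewrite normrX normrM lerD ?ler_pM ?lerXn2r ?nnegrE// ?hC ?SA.
rewrite hS SS.
have : \int[mu]_(x in `[-1, 1]) (h x ^+ 2) <= C ^+ 2 * (1 - - 1).
  apply: (le_trans (ler_norm _)); apply: normr_Rintegral_le; first lra.
    exact: measurable_funX.
  by move=> x x1; rewrite normrX lerXn2r ?nnegrE// hC.
rewrite -/B; lra.
Qed.

Lemma christoffel_darboux n (x t : R) :
  (t - x) * \sum_(0 <= k < n.+1) (k%:R + 2^-1) * ((P k).[x] * (P k).[t]) =
  n.+1%:R / 2 * ((P n.+1).[t] * (P n).[x] - (P n).[t] * (P n.+1).[x]).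
Proof.
elim: n => [|n IH].
  by rewrite big_nat1 legendre0 legendre1 !hornerC !hornerX; field.
rewrite big_nat_recr//= mulrDr IH.
have bonnet (y : R) : (P n.+2).[y] =
  ((2 * n.+1%:R + 1) * (y * (P n.+1).[y]) - n.+1%:R * (P n).[y]) / n.+2%:R.
  have := congr1 (horner^~ y) (legendre_bonnet R n).
  move: (P n.+2) (P n.+1) (P n) => a b c.
  rewrite /= (hornerMn _ a) hornerD hornerN 2!hornerMn hornerM hornerX.
  rewrite -[X in X = _]mulr_natr -[X in X - _]mulr_natr -[X in _ - X]mulr_natr natrD
    natrM => /(canRL (mulfK _)) ->.
    by congr (_ / _); ring.
  by rewrite pnatr_eq0.
rewrite !bonnet -[n.+2%:R]natr1; field.
by rewrite nat1r natr1 pnatr_eq0.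
Qed.


Lemma legendre_projE (f : R -> R) (C : R) n (x : R) : measurable_fun `[-1 : R, 1] f ->
  (forall x, -1 <= x <= 1 -> `|f x| <= C) ->
  legendre_proj f n x =
  moment f (\sum_(0 <= k < n.+1) ((k%:R + 2^-1) * (P k).[x]) *: P k).
Proof.
move=> mf fC; rewrite (moment_sum mf fC); apply: eq_bigr => k _.
by rewrite (momentZ mf fC) /legendre_coef /moment /Omega; ring.
Qed.

(** The projection reproduces constants, which allows f(x) to be moved under the integral in
    [legendre_proj_error]. *)
Lemma legendre_kernel_integral n (x : R) :
  polyint (\sum_(0 <= k < n.+1) ((k%:R + 2^-1) * (P k).[x]) *: P k) = 1.
Proof.
rewrite polyint_sum big_nat_recl//= big1_seq => [|k _].
  by rewrite polyintZ polyint_legendre0 legendre0 hornerC addr0; field.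
by rewrite polyintZ polyint_legendreS mulr0.
Qed.

Lemma measurable_diff_quotient (f : R -> R) x : measurable_fun `[-1 : R, 1] f ->
  measurable_fun `[-1 : R, 1] (diff_quotient f x).
Proof.
move=> mf; apply: measurable_funM; first exact: measurable_funB.
by apply: (measurableT_comp measurable_invr); exact: measurable_funB.
Qed.

Lemma lipschitz_const_ge0 (f : R -> R) (L x : R) : -1 <= x <= 1 ->
  (forall y, -1 <= y <= 1 -> `|f y - f x| <= L * `|y - x|) -> 0 <= L.
Proof.
move=> x1 fL; have [x0|x0] := leP x 0.
  have x0' : 0 < `|1 - x| by rewrite normr_gt0; lra.
  by rewrite -(pmulr_lge0 L x0') (le_trans _ (fL 1 _))//; lra.
have x0' : 0 < `|-1 - x| by rewrite normr_gt0; lra.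
by rewrite -(pmulr_lge0 L x0') (le_trans _ (fL (-1) _))//; lra.
Qed.

Lemma diff_quotient_bounded (f : R -> R) (L x : R) : -1 <= x <= 1 ->
  (forall y, -1 <= y <= 1 -> `|f y - f x| <= L * `|y - x|) ->
  forall y, -1 <= y <= 1 -> `|diff_quotient f x y| <= L.
Proof.
move=> x1 fL y y1; rewrite /diff_quotient; have [->|yx] := eqVneq y x.
  by rewrite subrr mul0r normr0 (lipschitz_const_ge0 x1 fL).
by rewrite normrM normfV ler_pdivrMr ?normr_gt0 ?subr_eq0// fL.
Qed.

(** Writing f(t) - f(x) = h(t) (t - x) supplies the factor t - x of the Christoffel-Darboux formula;
    only two moments of h survive. *)
Lemma legendre_proj_error (f : R -> R) (L x : R) n : -1 <= x <= 1 ->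
  measurable_fun `[-1 : R, 1] f ->
  (forall y, -1 <= y <= 1 -> `|f y - f x| <= L * `|y - x|) ->
  legendre_proj f n x - f x = n.+1%:R / 2 *
    ((P n).[x] * moment (diff_quotient f x) (P n.+1) -
     (P n.+1).[x] * moment (diff_quotient f x) (P n)).
Proof.
move=> x1 mf fL; set h := diff_quotient f x.
have L0 := lipschitz_const_ge0 x1 fL.
have fC y : -1 <= y <= 1 -> `|f y| <= `|f x| + L * 2.
  move=> y1; have -> : f y = f x + (f y - f x) by rewrite addrC subrK.
  rewrite (le_trans (ler_normD _ _))// lerD2l (le_trans (fL y y1))// ler_wpM2l//.
  by rewrite ler_norml; lra.
have mh := measurable_diff_quotient x mf.
have hC := diff_quotient_bounded x1 fL.
rewrite (legendre_projE n x mf fC).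
set K := \sum_(0 <= k < n.+1) _.
have KE t : K.[t] = \sum_(0 <= k < n.+1) (k%:R + 2^-1) * ((P k).[x] * (P k).[t]).
  by rewrite horner_sum; apply: eq_bigr => k _; rewrite hornerZ mulrA.
have -> : moment f K - f x = moment f K - moment (cst (f x)) K.
  rewrite [moment (cst _) _]RintegralZl//; last exact: integrable_horner.
  by rewrite -/(polyint K) legendre_kernel_integral mulr1.
have ifK := bounded_integrableM K mf fC.
have icK : mu.-integrable `[-1, 1] (EFin \o (fun t => cst (f x) t * K.[t])).
  by apply: (bounded_integrableM (C := `|f x|)) => //; exact: measurable_cst.
have -> : moment f K - moment (cst (f x)) K =
    \int[mu]_(t in `[-1, 1]) (f t * K.[t] - cst (f x) t * K.[t]).
  by rewrite /moment -RintegralB.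
transitivity (moment h ((n.+1%:R / 2) *: ((P n).[x] *: P n.+1 - (P n.+1).[x] *: P n))).
  apply: eq_Rintegral => t _; rewrite -mulrBl.
  have -> : f t - f x = h t * (t - x).
    (* At t = x the quotient is 0 by the convention for division by 0, and both sides vanish. *)
    rewrite /h /diff_quotient; have [->|tx] := eqVneq t x; first by rewrite !subrr mulr0.
    by rewrite divfK// subr_eq0.
  rewrite -mulrA KE christoffel_darboux; congr (_ * _).
  by move: (P n) (P n.+1) => p q; rewrite hornerZ hornerD hornerN !hornerZ; ring.
by rewrite (momentZ mh hC) (momentB mh hC) !(momentZ mh hC).
Qed.

End orthogonality.

(** * Convergence of the Legendre projections *)

Section convergence.
Variable R : realType.
Local Notation mu := (@lebesgue_measure R).
Local Notation P := (legendre R).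

Definition weight (x : R) : R := (1 - x ^+ 2) `^ (4^-1).

Lemma weight_ge0 x : 0 <= weight x.
Proof. exact: powR_ge0. Qed.

Lemma weight4 x : -1 <= x <= 1 -> weight x ^+ 4 = 1 - x ^+ 2.
Proof.
move=> x1; rewrite -powR_mulrn ?weight_ge0// /weight -powRrM mulVf ?powRr1//.
by nra.
Qed.

Lemma weight_legendre n x : (1 < n)%N -> -1 <= x <= 1 ->
  weight x * `|(P n).[x]| <= legendre_bound R n.
Proof.
move=> n1 x1; have h := legendre_bernstein R n x n1 x1.
have n2 : 2 <= n%:R :> R by rewrite ler_nat.
have b0 : 0 <= 2 / pi / (n%:R - 2^-1) :> R.
  by rewrite !divr_ge0 ?pi_ge0//; lra.
rewrite -(@ler_pXn2r _ 4) ?nnegrE ?mulr_ge0 ?weight_ge0 ?legendre_bound_ge0//.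
rewrite exprMn weight4// -normrX ger0_norm; last by rewrite (exprM _ 2 2) sqr_ge0.
by rewrite (exprM (legendre_bound R n) 2 2) /legendre_bound sqr_sqrtr.
Qed.

(** Two consecutive small terms are requested because the error of degree N involves the moments of
    degrees N and N + 1. *)
Lemma bounded_series_small (u : nat -> R) (B e : R) (K : nat) :
  (forall k, 0 <= u k) -> (forall N, \sum_(0 <= k < N) u k <= B) -> 0 < e ->
  exists2 N, (K <= N)%N & u N < e /\ u N.+1 < e.
Proof.
move=> u0 uB e0.
have cu : cvgn (series u).
  apply: nondecreasing_is_cvgn.
    apply/nondecreasing_seqP => n; rewrite /series/= big_nat_recr//=.
    by rewrite lerDl.
  by exists B => _ [n _ <-]; exact: uB.
have /cvgrPdist_lt/(_ e e0) [N _ HN] := cvg_series_cvg_0 cu.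
exists (maxn K N); first exact: leq_maxl.
split.
  have := HN (maxn K N); rewrite /= sub0r normrN ger0_norm//; apply.
  exact: leq_maxr.
have := HN (maxn K N).+1; rewrite /= sub0r normrN ger0_norm//; apply.
by rewrite /= (leq_trans (leq_maxr K N)).
Qed.

(** The factor (N + 1) / 2 of the Christoffel-Darboux formula is balanced by one N^(-1/2) from
    Bernstein's bound and another from the Bessel term. *)
Lemma weight_legendre_mul (u v x : R) N M : (1 < N)%N -> (N <= M)%N ->
  -1 <= x <= 1 -> 0 <= u -> (N%:R + 2^-1) * v ^+ 2 <= u ^+ 2 ->
  N.+1%:R / 2 * (weight x * `|(P M).[x]| * `|v|) <= 2 * u.
Proof.
move=> N1 NM x1 u0 vu.
have n2 : 2 <= N%:R :> R by rewrite ler_nat.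
have pi2 := pi_ge2 R.
apply: (@le_trans _ _ (N.+1%:R / 2 * (legendre_bound R N * `|v|))).
  rewrite ler_wpM2l// ler_wpM2r//.
  apply: (le_trans (weight_legendre (leq_trans N1 NM) x1)).
  by apply: legendre_bound_le => //; exact: ltnW.
rewrite -(@ler_pXn2r _ 2) ?nnegrE ?mulr_ge0 ?legendre_bound_ge0//.
rewrite !exprMn real_normK ?num_real// /legendre_bound sqr_sqrtr; last first.
  by rewrite !divr_ge0 ?pi_ge0//; lra.
rewrite -natr1; move: N%:R n2 (v ^+ 2) (sqr_ge0 v) (u ^+ 2) vu => n n2 w w0 s ws.
have tpi : 2 / pi <= 1 :> R by rewrite ler_pdivrMr; lra.
apply: (@le_trans _ _ ((n + 1) ^+ 2 * 2^-1 ^+ 2 * (1 / (n - 2^-1) * w))).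
  apply: ler_wpM2l; first by rewrite mulr_ge0 ?sqr_ge0.
  apply: ler_wpM2r => //; apply: ler_wpM2r => //.
  by rewrite invr_ge0; lra.
rewrite mul1r [_^-1 * w]mulrC mulrA ler_pdivrMr; last lra.
have : 0 <= (n - 2^-1) * (s - (n + 2^-1) * w) by rewrite mulr_ge0//; lra.
(* After squaring, the claim follows from (n + 1)^2 <= 16 (n - 1/2) (n + 1/2). *)
have : 0 <= w * (16 * (n ^+ 2 - 4^-1) - (n + 1) ^+ 2) by rewrite mulr_ge0//; nra.
by nra.
Qed.

Lemma weight_legendre_proj_cvg (f : R -> R) (L e x : R) n0 : -1 <= x <= 1 ->
  measurable_fun `[-1 : R, 1] f ->
  (forall y, -1 <= y <= 1 -> `|f y - f x| <= L * `|y - x|) -> 0 < e ->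
  exists2 N, (n0 <= N)%N & weight x * `|f x - legendre_proj f N x| <= e.
Proof.
move=> x1 mf fL e0; set h := diff_quotient f x.
have mh := measurable_diff_quotient x mf.
have hC := diff_quotient_bounded x1 fL.
pose u k := (k%:R + 2^-1) * moment h (P k) ^+ 2.
have u0 k : 0 <= u k by rewrite mulr_ge0 ?sqr_ge0.
have e4 : 0 < (e / 4) ^+ 2 by rewrite exprn_gt0// divr_gt0.
have [N NK [uN uSN]] := bounded_series_small (maxn n0 2) u0 (fun N => bessel N mh hC) e4.
have e4' : 0 <= e / 4 by rewrite divr_ge0// ltW.
exists N; first by rewrite (leq_trans _ NK)// leq_maxl.
have N1 : (1 < N)%N by rewrite (leq_trans _ NK)// leq_maxr.
rewrite distrC (legendre_proj_error N x1 mf fL) -/h normrM.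
rewrite [`|_ / 2|]ger0_norm ?divr_ge0//.
have h1 := @weight_legendre_mul (e / 4) (moment h (P N.+1)) x N N N1 (leqnn N) x1 e4'.
have h2 := @weight_legendre_mul (e / 4) (moment h (P N)) x N N.+1 N1 (leqnSn N) x1 e4'.
rewrite mulrCA.
apply: (@le_trans _ _ (N.+1%:R / 2 * (weight x * (`|(P N).[x]| * `|moment h (P N.+1)|
   + `|(P N.+1).[x]| * `|moment h (P N)|)))).
  rewrite ler_wpM2l// ler_wpM2l ?weight_ge0// -!normrM; exact: ler_normB.
rewrite !mulrDr !(mulrA (weight x)).
have -> : e = 2 * (e / 4) + 2 * (e / 4) by field.
apply: lerD; [apply: h1|apply: h2; exact: ltW].
(* The moment of degree N + 1 carries the weight N + 3/2 in Bessel's sum; it is lowered to N +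
   1/2. *)
apply: le_trans (ltW uSN); rewrite /u ler_wpM2r ?sqr_ge0// lerD2r ler_nat.
exact: leqnSn.
Qed.
End convergence.

(** * The weighted error *)

Section error_bound.
Variable R : realType.
Local Notation mu := (@lebesgue_measure R).
Local Notation P := (legendre R).

Lemma absolutely_continuous_lipschitz (a b : R) (f h : R -> R) (C : R) :
  absolutely_continuous a b f -> measurable_fun `[a, b] h ->
  (forall x, a <= x <= b -> `|h x| <= C) ->
  {ae mu, forall x, a <= x <= b -> linearized_on `[a, b] f x (h x)} ->
  forall x y, a <= x <= b -> a <= y <= b -> `|f y - f x| <= C * `|y - x|.
Proof.
move=> fab mh hC fh x y; wlog : x y / x <= y.
  move=> hw xab yab; have [xy|/ltW yx] := leP x y; first exact: hw.
  by rewrite distrC [`|y - x|]distrC hw.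
rewrite le_eqVlt => /predU1P[->|xy]; first by rewrite !subrr normr0 mulr0.
move=> /andP[ax _] /andP[_ yb].
have xyab t : x <= t <= y -> a <= t <= b.
  by move=> /andP[xt ty]; rewrite (le_trans ax)// (le_trans ty).
have mh' : measurable_fun `[x, y] h.
  by apply: measurable_funS mh => //; apply: subset_itv; rewrite bnd_simp.
have hC' t : x <= t <= y -> `|h t| <= C by move/xyab/hC.
rewrite -(absolutely_continuous_FTC xy _ mh' hC').
- by rewrite [`|y - x|]ger0_norm ?subr_ge0 ?(ltW xy)//;
  apply: normr_Rintegral_le => //; exact: ltW.
- exact: absolutely_continuousW fab.
- move: fh; apply: (@filterS _ _ (ae_filter_ringOfSetsType mu)) =>
  t ft /xyab/ft H e /H[d d0 K].
  exists d => // z; rewrite /= in_itv/= => /xyab zab; apply: K.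
  by rewrite /= in_itv.
Qed.

(** Up to the common factors this is 1 / (b - a + 1/2) - 1 / (b + 1/2) = a / ((b - a + 1/2) (b +
    1/2)) with a = m + 1 and b = n. The factor m + 1 becomes the m in the denominator of the final
    bound. *)
Lemma prod_telescope m n : (m < n)%N ->
  m.+1%:R * \prod_(1 <= l < m.+3) (n.+1%:R - l%:R + 2^-1)^-1 =
  \prod_(1 <= j < m.+2) (n%:R - j%:R + 2^-1)^-1 -
  \prod_(1 <= j < m.+2) (n.+1%:R - j%:R + 2^-1)^-1 :> R.
Proof.
move=> mn.
have shift k : \prod_(1 <= l < k.+2) (n.+1%:R - l%:R + 2^-1)^-1 =
  (n%:R + 2^-1)^-1 * \prod_(1 <= l < k.+1) (n%:R - l%:R + 2^-1)^-1 :> R.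
  rewrite big_nat_recl//; congr (_ * _); first by rewrite -natr1; congr (_^-1); ring.
  by apply: eq_big_nat => i _; congr (_^-1); rewrite -!natr1; ring.
rewrite !shift [\prod_(1 <= l < m.+2) _]big_nat_recr//=.
have mn' : m.+1%:R <= n%:R :> R by rewrite ler_nat.
have m0 : 1 <= m.+1%:R :> R by rewrite ler1n.
move: m.+1%:R n%:R mn' m0 (\prod_(_ <= _ < _) _) => a b ab a1 c.
field; apply/andP; split; lra.
Qed.

Lemma sum_telescope m n N : (m < n)%N ->
  \sum_(n.+1 <= k < (n + N).+1) m.+1%:R * \prod_(1 <= l < m.+3) (k%:R - l%:R + 2^-1)^-1 =
  \prod_(1 <= j < m.+2) (n%:R - j%:R + 2^-1)^-1 -
  \prod_(1 <= j < m.+2) ((n + N)%:R - j%:R + 2^-1)^-1 :> R.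
Proof.
move=> mn; elim: N => [|N IH]; first by rewrite addn0 subrr big_geq.
rewrite addnS big_nat_recr /=; last by rewrite ltnS leq_addr.
by rewrite IH prod_telescope ?(leq_trans mn) ?leq_addr//; ring.
Qed.

(** The bound at k is enlarged to the one at k - m; the square then supplies the factor of index m +
    1, one more than the coefficient bound has, which is what the telescoping needs. *)
Lemma legendre_bound_mul m k : (m < k)%N ->
  legendre_bound R (k - m) * legendre_bound R k <= 2 / pi * (k%:R - m.+1%:R + 2^-1)^-1.
Proof.
move=> mk.
apply: (@le_trans _ _ (legendre_bound R (k - m) ^+ 2)).
  rewrite expr2 ler_wpM2l ?legendre_bound_ge0// legendre_bound_le//; lia.
have h : 1 <= (k - m)%:R :> R by rewrite ler1n; lia.
rewrite /legendre_bound sqr_sqrtr; last by rewrite !divr_ge0 ?pi_ge0//; lra.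
rewrite le_eqVlt; apply/orP; left; apply/eqP; congr (_ * _^-1).
by rewrite natrB ?(ltnW mk)// -natr1; field.
Qed.

Lemma weight_legendre_proj_dist m (f : R -> R) (V : R) n N (x : R) :
  (m < n)%N -> -1 <= x <= 1 -> 0 <= V ->
  (forall k, (m.+1 < k)%N -> `|legendre_coef f k| <= V *
    legendre_bound R (k - m.+1) * \prod_(1 <= l < m.+2) (k%:R - l%:R + 2^-1)^-1) ->
  (n <= N)%N ->
  weight x * `|legendre_proj f N x - legendre_proj f n x| <=
  2 * V / (m.+1%:R * pi) * \prod_(1 <= j < m.+2) (n%:R - j%:R + 2^-1)^-1.
Proof.
move=> mn x1 V0 fV /subnKC <-; set d := (N - n)%N.
have pi0 := @pi_gt0 R.
have prod_ge0 k : (m < k)%N -> 0 <= \prod_(1 <= l < m.+2) (k%:R - l%:R + 2^-1)^-1 :> R.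
  move=> mk; rewrite big_nat_cond; apply: prodr_ge0 => i /andP[/andP[i1 im] _].
  have ik : i%:R <= k%:R :> R by rewrite ler_nat; lia.
  by rewrite invr_ge0; lra.
have -> : legendre_proj f (n + d) x - legendre_proj f n x =
    \sum_(n.+1 <= k < (n + d).+1) legendre_coef f k * (P k).[x].
  by rewrite /legendre_proj (@big_cat_nat _ _ _ n.+1)//= ?ltnS ?leq_addr// addrAC
    subrr add0r.
apply: (@le_trans _ _ (\sum_(n.+1 <= k < (n + d).+1)
   2 * V / (m.+1%:R * pi) * (m.+1%:R * \prod_(1 <= l < m.+3) (k%:R - l%:R + 2^-1)^-1))).
  apply: (@le_trans _ _ (weight x * \sum_(n.+1 <=
    k < (n + d).+1) `|legendre_coef f k * (P k).[x]|)).
    by rewrite ler_wpM2l ?weight_ge0// ler_norm_sum.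
  rewrite mulr_sumr big_nat_cond [leRHS]big_nat_cond;
    apply: ler_sum => k /andP[/andP[nk _] _].
  rewrite normrM mulrCA.
  have mk : (m.+1 < k)%N by lia.
  have wP : weight x * `|(P k).[x]| <=
    legendre_bound R k by apply: weight_legendre => //; lia.
  apply: (@le_trans _ _ (V * legendre_bound R (k - m.+1) *
      \prod_(1 <= l < m.+2) (k%:R - l%:R + 2^-1)^-1 * legendre_bound R k)).
    by apply: ler_pM => //; rewrite ?mulr_ge0 ?weight_ge0// fV.
  have -> : 2 * V / (m.+1%:R * pi) * (m.+1%:R * \prod_(1 <=
    l < m.+3) (k%:R - l%:R + 2^-1)^-1) =
     V * \prod_(1 <= l < m.+2) (k%:R - l%:R + 2^-1)^-1 * (2 / pi * (k%:R - m.+2%:R +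
       2^-1)^-1).
    rewrite (big_nat_recr m.+2)//=; have m0 : 1 <= m.+1%:R :> R by rewrite ler1n.
    move: (k%:R - m.+2%:R + 2^-1)^-1 (\prod_(_ <= _ < _) _) m.+1%:R m0 => b a c c0.
    by field; apply/andP; split; lra.
  rewrite -!mulrA ler_wpM2l// mulrCA ler_wpM2l ?prod_ge0 1?ltnW//.
  by rewrite mulrA; exact: legendre_bound_mul.
(* The subtracted product at n + d is nonnegative and dropped, so the bound no longer depends on
   N. *)
rewrite -mulr_sumr sum_telescope// ler_wpM2l//; last first.
  by rewrite gerBl prod_ge0// (leq_trans mn)// leq_addr.
by rewrite divr_ge0 ?mulr_ge0// ltW.
Qed.

(** Square roots make the continuity of the weight evident up to the endpoints, where 1 - x^2
    vanishes. *)
Lemma weight_sqrt x : -1 <= x <= 1 -> weight x = Num.sqrt (Num.sqrt (1 - x ^+ 2)) :> R.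
Proof.
move=> x1; apply: (@pexpIrn _ 4) => //; rewrite ?nnegrE ?weight_ge0 ?sqrtr_ge0//.
by rewrite weight4// (exprM _ 2 2) !sqr_sqrtr ?sqrtr_ge0//; nra.
Qed.

Lemma weighted_error_max (f : R -> R) n : {within `[-1, 1], continuous f} ->
  exists2 c, -1 <= c <= 1 & forall x, -1 <= x <= 1 ->
    weight x * `|f x - legendre_proj f n x| <= weight c * `|f c - legendre_proj f n c|.
Proof.
move=> cf.
pose q : {poly R} := \sum_(0 <= k < n.+1) legendre_coef f k *: P k.
have qE x : legendre_proj f n x = q.[x].
  by rewrite horner_sum; apply: eq_bigr => k _; rewrite [RHS]hornerZ.
pose F (x : R) := Num.sqrt (Num.sqrt (1 - x ^+ 2)) * `|f x - q.[x]|.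
have cF : {within `[-1, 1], continuous F}.
  have c1 : {within `[-1, 1], continuous (fun x : R => Num.sqrt (Num.sqrt (1 - x ^+ 2)))}.
    apply: continuous_subspaceT => x.
    apply: continuous_comp; last exact: sqrt_continuous.
    apply: continuous_comp; last exact: sqrt_continuous.
    by apply: cvgB; [exact: cvg_cst|exact: exprn_continuous].
  have c2 : {within `[-1, 1], continuous (fun x : R => q.[x])}.
    by apply: continuous_subspaceT => x; exact: continuous_horner.
  move=> x; apply: cvgM; first exact: c1.
  by apply: cvg_norm; apply: cvgB; [exact: cf|exact: c2].
have [|c c1 Fc] := EVT_max _ cF; first by lra.
exists c; first by move: c1; rewrite in_itv.
move=> x x1; rewrite !weight_sqrt//.
by rewrite !qE; apply: Fc; rewrite in_itv.
Qed.

Lemma weighted_error_le m (F : nat -> R -> R) n (x : R) :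
  (forall i, (i <= m)%N -> absolutely_continuous (-1) 1 (F i)) ->
  (forall i, (i <= m)%N ->
    {ae mu, forall x, -1 <= x <= 1 -> linearized_on `[-1, 1] (F i) x (F i.+1 x)}) ->
  bounded_variation (-1) 1 (F m.+1) -> (m < n)%N -> -1 <= x <= 1 ->
  weight x * `|F 0%N x - legendre_proj (F 0%N) n x| <=
  2 * fine (total_variation (-1) 1 (F m.+1)) / (m.+1%:R * pi) *
    \prod_(1 <= j < m.+2) (n%:R - j%:R + 2^-1)^-1.
Proof.
move=> Fac Fd FBV mn x1.
have F1m : measurable_fun `[-1 : R, 1] (F 1%N).
  case: m Fac Fd FBV mn => [|m] Fac Fd FBV mn; first exact: bounded_variation_measurable.
  by apply: absolutely_continuous_measurable; exact: Fac.
have [C F1C] : exists C : R, forall x, -1 <= x <= 1 -> `|F 1%N x| <= C.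
  case: m Fac Fd FBV mn {F1m} => [|m] Fac Fd FBV mn;
    first exact: bounded_variation_bounded.
  by apply: absolutely_continuous_bounded; exact: Fac.
have Flip := absolutely_continuous_lipschitz (Fac 0%N isT) F1m F1C (Fd 0%N isT).
have F0m := absolutely_continuous_measurable (Fac 0%N isT).
apply/ler_addgt0Pr => e e0.
have [N nN cN] := weight_legendre_proj_cvg n x1 F0m (fun y y1 => Flip x y x1 y1) e0.
have V0 : 0 <= fine (total_variation (-1) 1 (F m.+1)).
  by rewrite fine_ge0// total_variation_ge0//; lra.
have D := weight_legendre_proj_dist mn x1 V0
  (fun k => legendre_coef_le (F := F) (m := m.+1) (k := k) Fac Fd FBV) nN.
apply: le_trans (lerD D cN); rewrite -mulrDr ler_wpM2l ?weight_ge0//.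
have -> : F 0%N x - legendre_proj (F 0%N) n x =
  (legendre_proj (F 0%N) N x - legendre_proj (F 0%N) n x) +
  (F 0%N x - legendre_proj (F 0%N) N x) by ring.
exact: ler_normD.
Qed.

End error_bound.

Unset Implicit Arguments.

Theorem theorem3p8 (R : realType) (m : nat) (f g : R -> R) :
  (0 < m)%N ->
  (* f, f', ..., f^(m-1) exist and are absolutely continuous on [-1, 1] *)
  (forall k, (k.+1 < m)%N ->
     forall x, Omega x -> derivable_on Omega (derivn_on Omega k f) x) ->
  (forall k, (k < m)%N ->
     absolutely_continuous (-1) 1 (derivn_on Omega k f)) ->
  (* f^(m) is almost everywhere equal to g, which is of bounded variation *)
  {ae @lebesgue_measure R, forall x, Omega x ->
     is_derive_on Omega (derivn_on Omega m.-1 f) x (g x)} ->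
  bounded_variation (-1) 1 g ->
  let V := fine (total_variation (-1) 1 g) in
  (forall n, (m <= n)%N ->
     exists2 M : R,
       is_maximum_on Omega
         (fun x => (1 - x ^+ 2) `^ (4^-1) * `|f x - legendre_proj f n x|) M &
       M <= 2 * V / (m%:R * pi) *
            \prod_(1 <= j < m.+1) (n%:R - j%:R + 2^-1)^-1)
  /\
  (forall (tau : R) (n0 : nat), -1 < tau -> tau < 1 ->
     (forall n, (n0 <= n)%N ->
        `|f tau - legendre_proj f n tau|%:E =
        Linfty_norm (fun x => f x - legendre_proj f n x)) ->
     forall n, (maxn n0 m <= n)%N ->
       (Linfty_norm (fun x => f x - legendre_proj f n x)%R <=
        (2 * V / (pi * m%:R * (1 - tau ^+ 2) `^ (4^-1)) *
         \prod_(1 <= j < m.+1) (n%:R - j%:R + 2^-1)^-1)%:E)%E).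
Proof.
case: m => // m _ fder fac fg gBV V.
have OE (x : R) : -1 <= x <= 1 -> Omega x by rewrite /Omega /= in_itv.
(* After the case analysis the order of the theorem is m + 1; g stands in for the derivative of that
   order. *)
pose F i := if (i <= m)%N then derivn_on Omega i f else g.
have Fac i : (i <= m)%N -> absolutely_continuous (-1) 1 (F i).
  by move=> im; rewrite /F im; exact: fac.
have Fd i : (i <= m)%N -> {ae @lebesgue_measure R, forall x : R, -1 <= x <= 1 ->
    linearized_on `[-1, 1] (F i) x (F i.+1 x)}.
  rewrite leq_eqVlt => /predU1P[->|im].
    move: fg; apply: (@filterS _ _ (ae_filter_ringOfSetsType _)) => x H x1.
    rewrite /F leqnn ltnn; apply: is_derive_on_linearized; exact: H (OE _ x1).
  (* Below the last level the derivative exists everywhere: [derivable_on] is convergence to the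
     very limit that defines [derive_on]. *)
  apply: (@aeW _ _ _ (@lebesgue_measure R)) => x x1.
  rewrite /F (ltnW im) im; apply: is_derive_on_linearized.
  exact: fder im _ (OE _ x1).
have FBV : bounded_variation (-1) 1 (F m.+1) by rewrite /F ltnn.
have F0 : F 0%N = f by [].
have Fm : F m.+1 = g by rewrite /F ltnn.
have err n x : (m < n)%N -> -1 <= x <= 1 ->
  weight x * `|f x - legendre_proj f n x| <= 2 * V / (m.+1%:R * pi) *
            \prod_(1 <= j < m.+2) (n%:R - j%:R + 2^-1)^-1.
  by move=> mn x1; have := weighted_error_le Fac Fd FBV mn x1; rewrite F0 Fm.
split=> [n mn|tau n0 tau1 tau2 ftau n].
  have [c c1 fc] := weighted_error_max n (absolutely_continuous_within (fac 0%N isT)).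
  exists (weight c * `|f c - legendre_proj f n c|); last exact: err.
  split; first by exists c => //; exact: OE.
  by move=> x; rewrite /Omega /= in_itv/= => /fc.
rewrite geq_max => /andP[n0n mn]; rewrite -ftau// lee_fin.
have t1 : -1 <= tau <= 1 by rewrite !ltW.
(* Since tau is interior, the weighted bound at tau can be divided by the weight; the error there is
   the norm by assumption. *)
have w0 : 0 < weight tau by rewrite /weight powR_gt0// subr_gt0; nra.
have := err n tau mn t1; rewrite mulrC -ler_pdivlMr// => /le_trans; apply.
rewrite -/(weight tau) le_eqVlt; apply/orP; left; apply/eqP.
rewrite [pi * _]mulrC mulrAC; congr (_ * _).
by rewrite -[LHS]mulrA -invfM.
Qed.
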